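(* Let $\Bbbk$ be a perfect field and, for $n\ge 1$, let $B_n\subseteq A_n$ be the zigzag extension of radical-square-zero $\Bbbk$-algebras defined in the context. Then $$\operatorname{gldim}(A_n,B_n)=n .$$
   Context: Construction of $B_n\subseteq A_n$ ($n\ge1$). Let $Q^{(n)}$ be the quiver with vertex set $\{1,2,\dots,n+2\}$ whose arrows are all arrows in the following list having both endpoints in $\{1,\dots,n+2\}$: $1\to 2$, $1\to 3$, and, for each $k\ge 1$, $2k\to 2k+2$, $\;2k+1\to 2k+2$, $\;2k\to 2k+3$. Let $A_n=\Bbbk Q^{(n)}/\mathfrak r^2$, where $\mathfrak r$ is the ideal generated by all arrows. The vertices are arranged in columns $V_0=\{1\}$ and $V_i=\{2i,2i+1\}\cap\{1,\dots,n+2\}$ for $i\ge1$; each arrow goes from some column $V_i$ to $V_{i+1}$. $B_n$ is the subalgebra of $A_n$ generated by the idempotents $\sum_{v\in V_i}e_v$ (one for each nonempty column) and the elements $\sum_{x:V_i\to V_{i+1}}x$, the sum of all arrows from column $V_i$ to column $V_{i+1}$ (one for each pair of consecutive nonempty columns). Modules are left modules and paths are composed right to left (if $\alpha:1\to2$ and $\gamma:2\to4$, the path is $\gamma\alpha$). Relative homological algebra for an extension $B\subseteq A$ of finite-dimensional algebras ($B$ a unital subalgebra): $A\text{-mod}$ is the category of finitely generated left $A$-modules. A module $M\in A\text{-mod}$ is $(A,B)$-projective if the multiplication map $A\otimes_B M\to M$ is a split epimorphism of $A$-modules. An $(A,B)$-exact sequence is a complex of $A$-modules $(M_n,d_n)$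 admitting $B$-linear maps $h_n:M_n\to M_{n+1}$ with $d_{n+1}h_n+h_{n-1}d_n=1_{M_n}$ for all $n$. An $(A,B)$-projective resolution of $M$ is an $(A,B)$-exact sequence $\cdots\to P_1\to P_0\to M\to 0$ with all $P_i$ being $(A,B)$-projective. $\operatorname{pd}_{(A,B)}M$ is the least length of such a resolution (of $P_\bullet$), or $\infty$, and $\operatorname{gldim}(A,B)=\sup\{\operatorname{pd}_{(A,B)}M : M\in A\text{-mod}\}$. *)

(* Defs.v *)
From HB Require Import structures.
From mathcomp Require Import all_boot all_order all_algebra all_field.
From mathcomp Require Import boolp.

Set Implicit Arguments.
Unset Strict Implicit.
Unset Printing Implicit Defensive.

Import GRing.Theory.

Local Open Scope ring_scope.
Local Open Scope quotient_scope.

Definition perfect_field (K : fieldType) : Prop :=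
  forall p : {poly K}, irreducible_poly p -> separable_poly p.

(* The tensor product of A (as a right B-module) with a left A-module M
   restricted to B: formal sums of pairs a (x) m, taken modulo the congruence
   generated by the tensor relations. *)
Section Tensor.

Variables (K : fieldType) (A : falgType K) (B : {aspace A}) (M : lmodType A).
Implicit Types (a b : A) (x y z : M) (s t u : seq (A * M)).

Inductive tensor_rel : seq (A * M) -> seq (A * M) -> Prop :=
| TensorRefl s : tensor_rel s s
| TensorSym s t : tensor_rel s t -> tensor_rel t s
| TensorTrans s t u : tensor_rel s t -> tensor_rel t u -> tensor_rel s u
| TensorCat s s' t t' :
    tensor_rel s s' -> tensor_rel t t' -> tensor_rel (s ++ t) (s' ++ t')
| TensorComm s t : tensor_rel (s ++ t) (t ++ s)
| TensorZero x : tensor_rel [:: (0, x)] [::]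
| TensorAddl a b x : tensor_rel [:: (a + b, x)] [:: (a, x); (b, x)]
| TensorAddr a x y : tensor_rel [:: (a, x + y)] [:: (a, x); (a, y)]
| TensorBal a b x : b \in B -> tensor_rel [:: (a * b, x)] [:: (a, b *: x)].

Definition tensor_eqb s t : bool := `[<tensor_rel s t>].

Fact tensor_eqb_refl : reflexive tensor_eqb.
Proof. by move=> s; apply/asboolP; apply: TensorRefl. Qed.

Fact tensor_eqb_sym : symmetric tensor_eqb.
Proof. by move=> s t; apply/asboolP/asboolP; apply: TensorSym. Qed.

Fact tensor_eqb_trans : transitive tensor_eqb.
Proof.
by move=> t s u /asboolP st /asboolP tu; apply/asboolP; apply: TensorTrans tu.
Qed.

Canonical tensor_equiv :=
  EquivRel tensor_eqb tensor_eqb_refl tensor_eqb_sym tensor_eqb_trans.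

Definition tensor : Type := {eq_quot tensor_equiv}.
HB.instance Definition _ := Choice.on tensor.
HB.instance Definition _ := EqQuotient.on tensor.

Lemma tensor_piP s t : \pi_tensor s = \pi_tensor t <-> tensor_rel s t.
Proof.
split=> [/eqquotP/asboolP //|st]; by apply/eqquotP/asboolP.
Qed.

Lemma tensor_reprK (p : tensor) : \pi_tensor (repr p) = p.
Proof. exact: reprK. Qed.

Lemma tensor_repr s : tensor_rel (repr (\pi_tensor s)) s.
Proof. by apply/tensor_piP; rewrite tensor_reprK. Qed.

Definition pure a x : tensor := \pi_tensor [:: (a, x)].

Definition tensor_zero : tensor := \pi_tensor [::].
Definition tensor_add (p q : tensor) : tensor := \pi_tensor (repr p ++ repr q).
Definition lact a s : seq (A * M) := [seq (a * p.1, p.2) | p <- s].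
Definition tensor_opp (p : tensor) : tensor := \pi_tensor (lact (- 1) (repr p)).
Definition tensor_scale a (p : tensor) : tensor := \pi_tensor (lact a (repr p)).

Lemma lact_rel a s t : tensor_rel s t -> tensor_rel (lact a s) (lact a t).
Proof.
elim=> {s t}.
- by move=> s; apply: TensorRefl.
- by move=> s t _; apply: TensorSym.
- by move=> s t u _ st _; apply: TensorTrans st.
- by move=> s s' t t' _ ss _ tt; rewrite /lact !map_cat; apply: TensorCat.
- by move=> s t; rewrite /lact !map_cat; apply: TensorComm.
- by move=> x; rewrite /lact /= mulr0; apply: TensorZero.
- by move=> b c x; rewrite /lact /= mulrDr; apply: TensorAddl.
- by move=> b x y; rewrite /lact /=; apply: TensorAddr.
- by move=> b c x Bc; rewrite /lact /= mulrA; apply: TensorBal.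
Qed.

Lemma tensor_addE s t :
  tensor_add (\pi_tensor s) (\pi_tensor t) = \pi_tensor (s ++ t).
Proof. by apply/tensor_piP; apply: TensorCat; apply: tensor_repr. Qed.

Lemma tensor_scaleE a s :
  tensor_scale a (\pi_tensor s) = \pi_tensor (lact a s).
Proof. by apply/tensor_piP; apply/lact_rel/tensor_repr. Qed.

Lemma tensor_ind (P : tensor -> Prop) :
  (forall s, P (\pi_tensor s)) -> forall p, P p.
Proof. by move=> Ps p; rewrite -(tensor_reprK p). Qed.

Fact tensor_addA : associative tensor_add.
Proof.
elim/tensor_ind=> s; elim/tensor_ind=> t; elim/tensor_ind=> u.
by rewrite !tensor_addE catA.
Qed.

Fact tensor_addC : commutative tensor_add.
Proof.
elim/tensor_ind=> s; elim/tensor_ind=> t; rewrite !tensor_addE.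
by apply/tensor_piP/TensorComm.
Qed.

Fact tensor_add0 : left_id tensor_zero tensor_add.
Proof. by elim/tensor_ind=> s; rewrite tensor_addE. Qed.

Lemma lactDl a b s : tensor_rel (lact (a + b) s) (lact a s ++ lact b s).
Proof.
elim: s => [|[c x] s IHs]; first exact: TensorRefl.
rewrite /= mulrDl; apply: TensorTrans (TensorCat (TensorAddl _ _ _) IHs) _ => /=.
apply: (TensorCat (s := [:: _]) (s' := [:: _]) (TensorRefl _)).
have := TensorCat (TensorComm [:: (b * c, x)] (lact a s)) (TensorRefl (lact b s)).
by rewrite -!catA.
Qed.

Lemma lact0 s : tensor_rel (lact 0 s) [::].
Proof.
elim: s => [|[c x] s IHs]; first exact: TensorRefl.
by rewrite /= mul0r; apply: (TensorCat (TensorZero _) IHs).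
Qed.

Lemma lact1 s : lact 1 s = s.
Proof. by elim: s => [|[c x] s IHs] //=; rewrite mul1r IHs. Qed.

Fact tensor_addN : left_inverse tensor_zero tensor_opp tensor_add.
Proof.
elim/tensor_ind=> s; rewrite -[tensor_opp _]/(tensor_scale (- 1) _).
rewrite tensor_scaleE tensor_addE -{2}(lact1 s); apply/tensor_piP.
by apply: TensorTrans (TensorSym (lactDl _ _ _)) _; rewrite addNr; apply: lact0.
Qed.

HB.instance Definition _ := GRing.isZmodule.Build tensor
  tensor_addA tensor_addC tensor_add0 tensor_addN.

Lemma tensor_piD s t : \pi_tensor s + \pi_tensor t = \pi_tensor (s ++ t).
Proof. exact: tensor_addE. Qed.

Fact tensor_scaleA a b p :
  tensor_scale a (tensor_scale b p) = tensor_scale (a * b) p.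
Proof.
elim/tensor_ind: p => s; rewrite !tensor_scaleE /lact -map_comp.
by congr (\pi_tensor _); apply: eq_map => -[c x] /=; rewrite mulrA.
Qed.

Fact tensor_scale1 : left_id 1 tensor_scale.
Proof. by elim/tensor_ind=> s; rewrite tensor_scaleE lact1. Qed.

Fact tensor_scaleDr : right_distributive tensor_scale +%R.
Proof.
move=> a; elim/tensor_ind=> s; elim/tensor_ind=> t.
rewrite tensor_piD !tensor_scaleE tensor_piD.
by rewrite /lact map_cat.
Qed.

Fact tensor_scaleDl (p : tensor) :
  {morph tensor_scale^~ p : a b / a + b}.
Proof.
move=> a b; elim/tensor_ind: p => s.
by rewrite !tensor_scaleE tensor_piD; apply/tensor_piP/lactDl.
Qed.

HB.instance Definition _ := GRing.Zmodule_isLmodule.Build A tensor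
  tensor_scaleA tensor_scale1 tensor_scaleDr tensor_scaleDl.

Lemma scale_pure a b x : a *: pure b x = pure (a * b) x.
Proof. exact: tensor_scaleE. Qed.

Lemma pureDl a b x : pure (a + b) x = pure a x + pure b x.
Proof.
by rewrite tensor_piD; apply/tensor_piP/TensorAddl.
Qed.

Lemma pureDr a x y : pure a (x + y) = pure a x + pure a y.
Proof.
by rewrite tensor_piD; apply/tensor_piP/TensorAddr.
Qed.

Lemma pure_bal a b x : b \in B -> pure (a * b) x = pure a (b *: x).
Proof. by move=> Bb; apply/tensor_piP/TensorBal. Qed.

Lemma tensor_pi s : \pi_tensor s = \sum_(p <- s) pure p.1 p.2.
Proof.
elim: s => [|[a x] s IHs]; first by rewrite big_nil.
by rewrite big_cons -IHs tensor_piD.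
Qed.

Section Lift.

Variables (Z : zmodType) (f : A -> M -> Z).
Hypothesis fDl : forall x, {morph f^~ x : a b / a + b}.
Hypothesis fDr : forall a, {morph f a : x y / x + y}.
Hypothesis f_bal : forall a b x, b \in B -> f (a * b) x = f a (b *: x).

Definition tensor_lift (p : tensor) : Z := \sum_(q <- repr p) f q.1 q.2.

Lemma tensor_lift_rel s t :
  tensor_rel s t -> \sum_(q <- s) f q.1 q.2 = \sum_(q <- t) f q.1 q.2.
Proof.
elim=> {s t} //.
- by move=> s t u _ -> _ ->.
- by move=> s s' t t' _ ss _ tt; rewrite !big_cat ss tt.
- by move=> s t; rewrite !big_cat /= addrC.
- move=> x; rewrite big_seq1 big_nil /=; apply: (addrI (f 0 x)).
  by rewrite -fDl !addr0.
- by move=> a b x; rewrite big_seq1 big_cons big_seq1 fDl.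
- by move=> a x y; rewrite big_seq1 big_cons big_seq1 fDr.
- by move=> a b x Bb; rewrite !big_seq1 f_bal.
Qed.

Lemma tensor_liftE s :
  tensor_lift (\pi_tensor s) = \sum_(q <- s) f q.1 q.2.
Proof. exact/tensor_lift_rel/tensor_repr. Qed.

Lemma tensor_lift_pure a x : tensor_lift (pure a x) = f a x.
Proof. by rewrite tensor_liftE big_seq1. Qed.

Lemma tensor_liftD : {morph tensor_lift : p q / p + q}.
Proof.
elim/tensor_ind=> s; elim/tensor_ind=> t; 
by rewrite tensor_piD !tensor_liftE big_cat.
Qed.

Lemma tensor_lift_unique (g : tensor -> Z) :
    {morph g : p q / p + q} -> (forall a x, g (pure a x) = f a x) ->
  g =1 tensor_lift.
Proof.
move=> gD g_pure; elim/tensor_ind=> s; rewrite tensor_liftE tensor_pi.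
elim: s => [|q s IHs]; last by rewrite !big_cons gD g_pure IHs.
by rewrite !big_nil; apply: (addrI (g 0)); rewrite -gD !addr0.
Qed.

End Lift.

Definition mult_map : tensor -> M := tensor_lift (fun a x => a *: x).

Lemma mult_map_pure a x : mult_map (pure a x) = a *: x.
Proof.
apply: tensor_lift_pure => [y b c|b y z|b c y _]; first exact: scalerDl.
  exact: scalerDr.
by rewrite scalerA.
Qed.

Fact mult_map_linear : linear mult_map.
Proof.
move=> a; elim/tensor_ind=> s; elim/tensor_ind=> t; rewrite /mult_map.
have mD : forall x, {morph (fun b => b *: x) : b c / b + c}.
  by move=> x b c; rewrite scalerDl.
rewrite tensor_liftD; last by move=> b c x _; rewrite scalerA.
all: try by move=> b x y; rewrite scalerDr.
all: try by [].
congr (_ + _); rewrite -[a *: _ in LHS]/(tensor_scale a _) tensor_scaleE !tensor_liftE //.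
all: try by move=> b x y; rewrite scalerDr.
all: try by move=> b c x _; rewrite scalerA.
by rewrite big_map scaler_sumr; apply: eq_bigr => q _ /=; rewrite scalerA.
Qed.

HB.instance Definition _ := GRing.isLinear.Build A tensor M *:%R mult_map
  mult_map_linear.

End Tensor.

Section RelativeHomology.

Variables (K : fieldType) (A : falgType K) (B : {aspace A}).

Definition fin_gen (M : lmodType A) : Prop :=
  exists s : seq M, forall x, exists c : 'I_(size s) -> A,
    x = \sum_(i < size s) c i *: s`_i.

Definition rel_projective (M : lmodType A) : Prop :=
  exists sec : {linear M -> tensor B M}, forall x, mult_map (sec x) = x.

Definition sub_linear (M N : lmodType A) (f : M -> N) : Prop :=
  {morph f : x y / x + y} /\ (forall b x, b \in B -> f (b *: x) = b *: f x).

(* X i is the module in degree i, and the complex continues with zeros to the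
   right of X 0. *)
Definition rel_exact (X : nat -> lmodType A)
    (d : forall i, {linear X i.+1 -> X i}) : Prop :=
  (forall i x, d i (d i.+1 x) = 0) /\
  exists h : forall i, X i -> X i.+1,
    [/\ forall i, sub_linear (h i),
        forall x, d 0%N (h 0%N x) = x
      & forall i x, d i.+1 (h i.+1 x) + h i (d i x) = x].

Definition augmented (M : lmodType A) (P : nat -> lmodType A) (i : nat) :
  lmodType A := if i is j.+1 then P j else M.

(* M has an (A, B)-projective resolution 0 -> P m -> ... -> P 0 -> M -> 0 *)
Definition rel_resolution (M : lmodType A) (m : nat) : Prop :=
  exists (P : nat -> lmodType A)
         (d : forall i, {linear augmented M P i.+1 -> augmented M P i}),
    [/\ rel_exact d,
        forall i, fin_gen (P i),
        forall i, rel_projective (P i)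
      & forall i, (m < i)%N -> forall x : P i, x = 0].

(* Least element, where None stands for infinity. *)
Definition inf_nat (S : nat -> Prop) : option nat :=
  match pselect (exists m, `[<S m>]) with
  | left S_ex => Some (ex_minn S_ex)
  | right _ => None
  end.

Definition le_inf (a : option nat) (m : nat) : Prop :=
  if a is Some i then (i <= m)%N else False.

Definition rel_pd (M : lmodType A) : option nat := inf_nat (rel_resolution M).

(* The supremum is the least upper bound. *)
Definition rel_gldim : option nat :=
  inf_nat (fun m => forall M : lmodType A, fin_gen M -> le_inf (rel_pd M) m).

End RelativeHomology.

(* The vertex set 'I_m.+1 is nonempty, so that path algebras are nonzero. *)
Record quiver (m : nat) := Quiver {
  arrow : finType;
  src : arrow -> 'I_m.+1;
  tgt : arrow -> 'I_m.+1
}.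

(* k Q / r^2 has as basis the classes of the paths of length 0 and 1: the
   vector f is the combination of the idempotents e_v with coefficients
   f (inl v) and of the arrows x with coefficients f (inr x). The type is an
   alias because {ffun _ -> K} already carries the pointwise product. *)
Definition radsq (K : fieldType) (m : nat) (Q : quiver m) : Type :=
  {ffun 'I_m.+1 + arrow Q -> K^o}.

HB.instance Definition _ (K : fieldType) (m : nat) (Q : quiver m) :=
  Vector.copy (radsq K Q) {ffun 'I_m.+1 + arrow Q -> K^o}.

Section RadicalSquareZero.

Variables (K : fieldType) (m : nat) (Q : quiver m).
Local Notation A := (radsq K Q).
Implicit Types f g h : A.

Definition videm (v : 'I_m.+1) : A :=
  [ffun p : 'I_m.+1 + arrow Q => (p == inl v)%:R : K^o].

Definition varrow (x : arrow Q) : A :=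
  [ffun p : 'I_m.+1 + arrow Q => (p == inr x)%:R : K^o].

Definition radsq_one : A :=
  [ffun p : 'I_m.+1 + arrow Q => (if p is inl _ then 1 else 0) : K^o].

(* Bilinear extension of the right-to-left composition of paths, see
   videmM, videm_arrow, varrow_idem and varrowM below. *)
Definition radsq_mul f g : A :=
  [ffun p : 'I_m.+1 + arrow Q =>
     match p with
     | inl v => (f (inl v) : K) * g (inl v)
     | inr x => (f (inl (tgt x)) : K) * g (inr x) + (f (inr x) : K) * g (inl (src x))
     end : K^o].

Fact radsq_mulA : associative radsq_mul.
Proof.
move=> f g h; apply/ffunP=> -[v|x]; rewrite !ffunE /= ?mulrA //.
by rewrite mulrDr mulrDl !mulrA addrA.
Qed.

Fact radsq_mul1 : left_id radsq_one radsq_mul.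
Proof. by move=> f; apply/ffunP=> -[v|x]; rewrite !ffunE /= mul1r ?mul0r ?addr0. Qed.

Fact radsq_1mul : right_id radsq_one radsq_mul.
Proof. by move=> f; apply/ffunP=> -[v|x]; rewrite !ffunE /= ?mulr1 ?mulr0 ?add0r. Qed.

Fact radsq_mulDl : left_distributive radsq_mul +%R.
Proof.
move=> f g h; apply/ffunP=> -[v|x]; rewrite !ffunE /= !mulrDl //.
by rewrite addrACA.
Qed.

Fact radsq_mulDr : right_distributive radsq_mul +%R.
Proof.
move=> f g h; apply/ffunP=> -[v|x]; rewrite !ffunE /= !mulrDr //.
by rewrite addrACA.
Qed.

Fact radsq_1neq0 : radsq_one != 0.
Proof.
apply/eqP=> /ffunP/(_ (inl ord0)); rewrite !ffunE /=.
by apply/eqP; rewrite oner_eq0.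
Qed.

HB.instance Definition _ := GRing.Zmodule_isNzRing.Build A
  radsq_mulA radsq_mul1 radsq_1mul radsq_mulDl radsq_mulDr radsq_1neq0.

Fact radsq_scaleAl (a : K) f g : a *: (f * g) = (a *: f) * g.
Proof.
apply/ffunP=> -[v|x]; rewrite !ffunE /= /GRing.scale /= ?mulrA //.
by rewrite mulrDr !mulrA.
Qed.

HB.instance Definition _ := GRing.Lmodule_isLalgebra.Build K A radsq_scaleAl.

Fact radsq_scaleAr (a : K) f g : a *: (f * g) = f * (a *: g).
Proof.
apply/ffunP=> -[v|x]; rewrite !ffunE /= /GRing.scale /=.
  by rewrite mulrCA.
by rewrite mulrDr mulrCA [in X in _ + X]mulrCA.
Qed.

HB.instance Definition _ := GRing.Lalgebra_isAlgebra.Build K A radsq_scaleAr.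
HB.instance Definition _ := Algebra_isFalgebra.Build K A.

Lemma videmM u v : videm u * videm v = if u == v then videm v else 0.
Proof.
apply/ffunP=> -[w|x]; rewrite !ffunE /=.
  have [<-|neq] := eqVneq u v; first by rewrite !ffunE -natrM mulnb andbb.
  rewrite !ffunE -natrM mulnb; case: eqP => // -[->]; case: eqP => // -[uv].
  by rewrite uv eqxx in neq.
by case: ifP => _; rewrite !ffunE /= ?mulr0 ?mul0r ?addr0.
Qed.

Lemma videm_arrow v x : videm v * varrow x = if tgt x == v then varrow x else 0.
Proof.
apply/ffunP=> -[w|y]; rewrite !ffunE /=.
  by case: ifP => _; rewrite !ffunE /= mulr0.
rewrite mul0r addr0; have [->|neq] := eqVneq y x.
  by rewrite (inj_eq inl_inj); case: ifP => _; rewrite !ffunE /= ?eqxx ?mul1r ?mul0r.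
have ne : (inr y == inr x :> 'I_m.+1 + arrow Q) = false by rewrite (inj_eq inr_inj) (negPf neq).
by rewrite ne mulr0; case: ifP => _; rewrite !ffunE ?ne.
Qed.

Lemma varrow_idem v x : varrow x * videm v = if src x == v then varrow x else 0.
Proof.
apply/ffunP=> -[w|y]; rewrite !ffunE /=.
  by case: ifP => _; rewrite !ffunE /= mul0r.
rewrite mul0r add0r; have [->|neq] := eqVneq y x.
  by rewrite (inj_eq inl_inj); case: ifP => _; rewrite !ffunE /= ?eqxx ?mul1r ?mul0r.
have ne : (inr y == inr x :> 'I_m.+1 + arrow Q) = false by rewrite (inj_eq inr_inj) (negPf neq).
by rewrite ne mul0r; case: ifP => _; rewrite !ffunE ?ne.
Qed.

Lemma varrowM x y : varrow x * varrow y = 0.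
Proof. by apply/ffunP=> -[w|z]; rewrite !ffunE /= ?mul0r ?mulr0 ?addr0. Qed.

Lemma radsq_oneE : 1 = \sum_v videm v.
Proof.
apply/ffunP=> p; rewrite sum_ffunE !ffunE /=.
case: p => [v|x]; last by rewrite big1 // => v _; rewrite ffunE.
rewrite (bigD1 v) //= ffunE eqxx big1 ?addr0 // => w neq.
by rewrite ffunE (inj_eq inl_inj) eq_sym (negPf neq).
Qed.

Lemma radsq_basis f :
  f = \sum_v (f (inl v) : K) *: videm v + \sum_x (f (inr x) : K) *: varrow x.
Proof.
apply/ffunP=> p; rewrite ffunE !sum_ffunE.
case: p => [v|x].
  rewrite (bigD1 v) //= big1 => [|w neq]; last first.
    by rewrite !ffunE (inj_eq inl_inj) eq_sym (negPf neq) scaler0.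
  rewrite big1 => [|y _]; last by rewrite !ffunE scaler0.
  by rewrite !ffunE eqxx !addr0 /GRing.scale /= mulr1.
rewrite big1 => [|y _]; last by rewrite !ffunE scaler0.
rewrite (bigD1 x) //= big1 => [|w neq]; last first.
  by rewrite !ffunE (inj_eq inr_inj) eq_sym (negPf neq) scaler0.
by rewrite !ffunE eqxx addr0 add0r /GRing.scale /= mulr1.
Qed.

(* The universal property of the path algebra modulo the square of its arrow
   ideal. *)
Lemma radsq_universal (C : algType K) (e : 'I_m.+1 -> C) (c : arrow Q -> C) :
  (forall u v, e u * e v = if u == v then e v else 0) ->
  \sum_v e v = 1 ->
  (forall x, e (tgt x) * c x * e (src x) = c x) ->
  (forall x y, c x * c y = 0) ->
  exists phi : A -> C,
    [/\ linear phi, monoid_morphism phi,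
        (forall v, phi (videm v) = e v) & (forall x, phi (varrow x) = c x)].
Proof.
move=> ee e1 ece cc.
have ec v x : e v * c x = if tgt x == v then c x else 0.
  rewrite -ece !mulrA ee eq_sym; case: eqP => [->|_] //; by rewrite !mul0r.
have ce v x : c x * e v = if src x == v then c x else 0.
  rewrite -ece -!mulrA ee; case: eqP => [->|_] //; by rewrite !mulr0.
pose phi f : C := \sum_v (f (inl v) : K) *: e v + \sum_x (f (inr x) : K) *: c x.
have phiD : linear phi.
  move=> a f g; rewrite /phi scalerDr !scaler_sumr addrACA -!big_split /=.
  by congr (_ + _); apply: eq_bigr => i _; rewrite !ffunE scalerDl scalerA.
have phiv v : phi (videm v) = e v.
  rewrite /phi [X in _ + X]big1 => [|x _]; last by rewrite ffunE scale0r.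
  rewrite addr0 (bigD1 v) //= big1 => [|w neq].
    by rewrite ffunE eqxx scale1r addr0.
  by rewrite ffunE (inj_eq inl_inj) (negPf neq) scale0r.
have phic x : phi (varrow x) = c x.
  rewrite /phi big1 => [|v _]; last by rewrite ffunE scale0r.
  rewrite add0r (bigD1 x) //= big1 => [|y neq].
    by rewrite ffunE eqxx scale1r addr0.
  by rewrite ffunE (inj_eq inr_inj) (negPf neq) scale0r.
exists phi; split=> //; split=> [|f g].
  rewrite /phi -e1 [X in _ + X]big1 => [|x _]; last by rewrite ffunE scale0r.
  by rewrite addr0; apply: eq_bigr => v _; rewrite ffunE scale1r.
have ev v h : e v * phi h =
    (h (inl v) : K) *: e v + \sum_(x | tgt x == v) (h (inr x) : K) *: c x.
  rewrite /phi mulrDr !mulr_sumr (bigD1 v) //= big1 => [|w neq].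
    rewrite -scalerAr ee eqxx addr0; congr (_ + _); rewrite [RHS]big_mkcond /=.
    by apply: eq_bigr => x _; rewrite -scalerAr ec; case: ifP; rewrite ?scaler0.
  by rewrite -scalerAr ee eq_sym (negPf neq) scaler0.
have cx x h : c x * phi h = (h (inl (src x)) : K) *: c x.
  rewrite /phi mulrDr !mulr_sumr (bigD1 (src x)) //= big1 => [|w neq]; last first.
    by rewrite -scalerAr ce eq_sym (negPf neq) scaler0.
  rewrite big1 => [|y _]; last by rewrite -scalerAr cc scaler0.
  by rewrite -scalerAr ce eqxx !addr0.
rewrite {2}/phi mulrDl !mulr_suml.
under eq_bigr do rewrite -scalerAl ev scalerDr scalerA.
under [X in _ + X]eq_bigr do rewrite -scalerAl cx scalerA.
rewrite big_split /= -addrA; congr (_ + _).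
  by apply: eq_bigr => v _; rewrite ffunE.
rewrite (eq_bigr (fun v => \sum_(x | tgt x == v)
    ((f (inl (tgt x)) : K) * g (inr x)) *: c x)) => [|v _]; last first.
  by rewrite scaler_sumr; apply: eq_bigr => x /eqP <-; rewrite scalerA.
rewrite -(@partition_big _ _ _ _ _ _ predT (@tgt _ Q) predT) // -big_split /=.
by apply: eq_bigr => x _; rewrite ffunE scalerDl.
Qed.

End RadicalSquareZero.

Section Zigzag.

Local Open Scope nat_scope.

(* For k > n + 2 the arrows do not have endpoints among 1, ..., n + 2. *)
Definition zigzag_list (n : nat) : seq (nat * nat) :=
  [:: (1, 2); (1, 3)] ++
  flatten [seq [:: (2 * k, 2 * k + 2); (2 * k + 1, 2 * k + 2);
                   (2 * k, 2 * k + 3)] | k <- iota 1 (n + 2)].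

(* The element i of 'I_n.+2 stands for the vertex i + 1. *)
Definition label (n : nat) (i : 'I_n.+2) : nat := i.+1.

Definition zigzag_arrow (n : nat) : finType :=
  {p : 'I_n.+2 * 'I_n.+2 | (label p.1, label p.2) \in zigzag_list n}.

Definition zigzag (n : nat) : quiver n.+1 :=
  @Quiver n.+1 (zigzag_arrow n) (fun x => (val x).1) (fun x => (val x).2).

(* v lies in V_i iff column v = i *)
Definition column (n : nat) (v : 'I_n.+2) : nat := (label v)./2.

End Zigzag.

Definition zigzag_alg (K : fieldType) (n : nat) : falgType K :=
  radsq K (zigzag n).

Definition column_idem (K : fieldType) (n i : nat) : zigzag_alg K n :=
  \sum_(v : 'I_n.+2 | column v == i) videm K (zigzag n) v.

Definition column_arrows (K : fieldType) (n i : nat) : zigzag_alg K n :=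
  \sum_(x : arrow (zigzag n) | (column (src x) == i) && (column (tgt x) == i.+1))
     varrow K x.

Definition zigzag_subalg (K : fieldType) (n : nat) : {aspace zigzag_alg K n} :=
  <<<<[seq column_idem K n i | i <- iota 0 (n.+2)./2.+1] ++
      [seq column_arrows K n i | i <- iota 0 (n.+2)./2]>>>>%AS.

Lemma zigzag_subalg1 (K : fieldType) (n : nat) : 1 \in zigzag_subalg K n.
Proof. by rewrite memvE /= sub1_agenv. Qed.

(* Main.v *)
Require Import Defs.
From HB Require Import structures.
From mathcomp Require Import all_boot all_order all_algebra all_field.
From mathcomp Require Import boolp zify ring.

(* Upper bound. Write V_s for the columns, f_s for the sum of the e_v with v in
   V_s, and a for the sum of all arrows. Let M be supported on the columns
   >= s >= 1, and let K be the kernel of the multiplication A (x)_B M -> M. On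
   column s the total arrow a is injective on K, with an explicit retraction;
   hence, adjoining to B the idempotents of the vertices of V_s to get B', the
   module A (x)_B' K is (A,B)-projective. The kernel of A (x)_B' K -> K vanishes
   on column s, so two steps of a resolution raise the support by one column.
   Column 0 is a single vertex and costs one step, and so does the passage to a
   last column with a single vertex; modules supported on the last column are
   (A,B)-projective. The total is n.

   Lower bound. The module with basis the vertices 1, 2 has an explicit
   (A,B)-projective resolution by thin modules, whose supports are
   {1, 2, 3}, {2, 3, 4}, {2, 4, 5}, {4, 5, 6}, {4, 6, 7}, ... If there were a
   resolution of length m < n, the comparison theorem would give a map s with
   d s d = d in degree n, which is impossible at the vertex n + 2. *)

Set Implicit Arguments.
Unset Strict Implicit.
Unset Printing Implicit Defensive.

Import GRing.Theory.

Local Open Scope ring_scope.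

(** * Relative homological algebra *)

(** The obstacle is the vertex idempotents: a B-linear map commuting with all e_v is A-linear.
    Averaging a B-linear section over the e_v with v in V_s gives this on column s, but spoils
    commutation with a. The defect must be carried to column s + 1 along a, which is consistent only
    where a is injective on column s. This is why a first step replaces M by K: there injectivity
    comes from 2s and 2s + 1 having the common target 2s + 2. The second step, over B', moves the
    e_v across the tensor sign, so that the next kernel loses column s. The bound for a module
    starting in column s is the number of vertices beyond that column.

    For the lower bound, the syzygies of the module on 1, 2 alternate between the simple module at
    2k + 1 and the uniserial module on 2k, 2k + 2. The former is covered by A (x)_B S on 2k, 2k + 1,
    2k + 2, with S the simple B-module of column k; the latter by the projective A e_2k on 2k, 2k +
    2, 2k + 3. *)

Section Kernel.

Variables (R : nzRingType) (M N : lmodType R) (f : {linear M -> N}).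

Definition in_kernel : {pred M} := fun x => f x == 0.

Fact in_kernel_submod : submod_closed in_kernel.
Proof.
split=> [|a x y /eqP fx /eqP fy]; first by rewrite unfold_in linear0.
by rewrite unfold_in linearP fx fy scaler0 addr0.
Qed.

HB.instance Definition _ :=
  GRing.isSubmodClosed.Build R M in_kernel in_kernel_submod.

Definition kernel : Type := {x | in_kernel x}.
HB.instance Definition _ := SubChoice.on kernel.
HB.instance Definition _ := [SubChoice_isSubLmodule of kernel by <:].

Lemma kernel_valD (k l : kernel) : val (k + l) = val k + val l.
Proof. exact: (linearD (\val : {linear kernel -> M})). Qed.

Lemma kernel_valZ a (k : kernel) : val (a *: k) = a *: val k.
Proof. exact: (linearZZ (\val : {linear kernel -> M})). Qed.

Lemma kernelP (k : kernel) : f (val k) = 0.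
Proof. exact/eqP/(valP k). Qed.

Lemma kernel_intro x : f x = 0 -> exists k : kernel, val k = x.
Proof. by move/eqP=> fx; exists (Sub x fx); rewrite SubK. Qed.

End Kernel.

(** The generated subalgebra is a sum of powers of the span, so a property stable under the algebra
    operations passes from the generators to each power and then to the sum. *)
Lemma agenv_span_ind (K : fieldType) (A : falgType K) (s : seq A) (P : A -> Prop) :
    P 1 -> (forall c x y, P x -> P y -> P (c *: x + y)) ->
    (forall x y, P x -> P y -> P (x * y)) -> (forall u, u \in s -> P u) ->
  forall b, b \in agenv <<s>> -> P b.
Proof.
move=> P1 PZD PM Ps.
have P0 : P 0 by rewrite -(addNr 1) -scaleN1r; apply: PZD.
have PZ c x : P x -> P (c *: x) by move=> Px; rewrite -[_ *: _]addr0; apply: PZD.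
have PD x y : P x -> P y -> P (x + y) by rewrite -{2}[x]scale1r; apply: PZD.
have Pspan (t : seq A) : (forall x, x \in t -> P x) -> forall b, b \in <<t>>%VS -> P b.
  move=> Pt b /(coord_span (X := in_tuple t)) ->; apply: big_ind => // i _.
  by apply/PZ/Pt/mem_nth.
have PX k : forall b, b \in (<<s>> ^+ k)%VS -> P b.
  elim: k => [|k IHk] b; first by rewrite expv0 => /vlineP[c ->]; apply: PZ.
  rewrite expvSl /prodv unlock; apply: (@Pspan) => x /allpairsP[[u v] /= [Uu Uv ->]].
  by apply: PM; [apply/(Pspan _ Ps)/vbasis_mem | apply/IHk/vbasis_mem].
by move=> b /memv_sumP[F PF ->]; apply: big_ind => // i _; apply/(PX i)/PF.
Qed.

(** * Tensor products over a subalgebra and induced maps *)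

Section TensorTheory.

Variables (K : fieldType) (A : falgType K) (B : {aspace A}).
Hypothesis B1 : 1 \in B.
Implicit Types M N P : lmodType A.

Lemma scalar_in c : c%:A \in B.
Proof. exact: memvZ. Qed.

Lemma scalar_comm c (a : A) M (m : M) : a *: (c%:A *: m) = c%:A *: (a *: m).
Proof. by rewrite !scalerA -scalerAl -scalerAr mul1r mulr1. Qed.

Lemma scalarE c M (a : A) (m : M) : (c *: a) *: m = c%:A *: (a *: m).
Proof. by rewrite scalerA -scalerAl mul1r. Qed.

Lemma sub_linear0 M N (f : M -> N) : sub_linear B f -> f 0 = 0.
Proof. by case=> fD _; apply: (addrI (f 0)); rewrite -fD !addr0. Qed.

Lemma sub_linear_sum M N (f : M -> N) : sub_linear B f ->
  forall (I : Type) (r : seq I) (Q : pred I) F,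
  f (\sum_(i <- r | Q i) F i) = \sum_(i <- r | Q i) f (F i).
Proof.
move=> fB I r Q F; exact: (big_morph f (proj1 fB) (sub_linear0 fB)).
Qed.

Lemma tensor_elim M (Q : tensor B M -> Prop) :
  Q 0 -> (forall t u, Q t -> Q u -> Q (t + u)) -> (forall a m, Q (pure B a m)) ->
  forall t, Q t.
Proof.
move=> Q0 QD Qp; elim/tensor_ind => s; rewrite tensor_pi.
by apply: big_ind => // p _; apply: Qp.
Qed.

Lemma pure0l M (m : M) : pure B 0 m = 0.
Proof. by apply: (addrI (pure B 0 m)); rewrite -pureDl !addr0. Qed.

Lemma pure0r M (a : A) : pure B a (0 : M) = 0.
Proof. by apply: (addrI (pure B a (0 : M))); rewrite -pureDr !addr0. Qed.

Lemma pureNl M (a : A) (m : M) : pure B (- a) m = - pure B a m.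
Proof. by apply: (addrI (pure B a m)); rewrite -pureDl !subrr pure0l. Qed.

Lemma pureNr M (a : A) (m : M) : pure B a (- m) = - pure B a m.
Proof. by apply: (addrI (pure B a m)); rewrite -pureDr !subrr pure0r. Qed.

Lemma pure_suml M (m : M) (I : Type) (r : seq I) (Q : pred I) (F : I -> A) :
  pure B (\sum_(i <- r | Q i) F i) m = \sum_(i <- r | Q i) pure B (F i) m.
Proof. by apply: (big_morph (fun a => pure B a m)) => [a b|]; rewrite ?pureDl ?pure0l. Qed.

Lemma pure_sumr M (a : A) (I : Type) (r : seq I) (Q : pred I) (F : I -> M) :
  pure B a (\sum_(i <- r | Q i) F i) = \sum_(i <- r | Q i) pure B a (F i).
Proof. by apply: (big_morph (pure B a)) => [x y|]; rewrite ?pureDr ?pure0r. Qed.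

Lemma pure_scalar M c (a : A) (m : M) : pure B (c *: a) m = pure B a (c%:A *: m).
Proof. by rewrite -pure_bal ?scalar_in // -scalerAr mulr1. Qed.

Lemma pure1_sub_linear M : sub_linear B (@pure K A B M 1).
Proof.
by split=> [x y|b x Bb]; rewrite ?pureDr // scale_pure mulr1 -pure_bal // mul1r.
Qed.

Lemma mult_mapD M (t u : tensor B M) : mult_map (t + u) = mult_map t + mult_map u.
Proof. exact: (linearD (mult_map (B := B) (M := M))). Qed.

Lemma mult_mapZ M (b : A) (t : tensor B M) : mult_map (b *: t) = b *: mult_map t.
Proof. exact: (linearZZ (mult_map (B := B) (M := M))). Qed.

Section Induced.

Variables (M N : lmodType A) (h : M -> N).
Hypothesis hB : sub_linear B h.

(** The A-linear map adjoint to the B-linear map [h], under the adjunction between induction and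
    restriction. *)
Definition induced (t : tensor B M) : N := tensor_lift (fun a m => a *: h m) t.

Lemma induced_pure a m : induced (pure B a m) = a *: h m.
Proof.
apply: tensor_lift_pure => [x b c|b x y|b c x Bc]; first exact: scalerDl.
  by rewrite (proj1 hB) scalerDr.
by rewrite (proj2 hB) // scalerA.
Qed.

Lemma inducedD : {morph induced : t u / t + u}.
Proof.
apply: tensor_liftD => [x b c|b x y|b c x Bc]; first exact: scalerDl.
  by rewrite (proj1 hB) scalerDr.
by rewrite (proj2 hB) // scalerA.
Qed.

Lemma induced0 : induced 0 = 0.
Proof. by apply: (addrI (induced 0)); rewrite -inducedD !addr0. Qed.

Fact induced_linear : linear induced.
Proof.
move=> a t u; rewrite inducedD; congr (_ + _).
elim/tensor_elim: t => [|t1 t2 IH1 IH2|b m]; first by rewrite scaler0 !induced0 scaler0.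
  by rewrite scalerDr !inducedD IH1 IH2 scalerDr.
by rewrite scale_pure !induced_pure scalerA.
Qed.

Lemma induced_as_linear : exists w : {linear tensor B M -> N}, w =1 induced.
Proof.
pose v := GRing.isLinear.Build _ _ _ _ _ induced_linear.
by exists (HB.pack induced v : {linear tensor B M -> N}).
Qed.

End Induced.

Lemma induced_mult M N (Q : lmodType A) (h : M -> N) (hB : sub_linear B h) (p : {linear N -> Q})
    (u : {linear M -> Q}) :
  (forall x, p (h x) = u x) -> forall t, p (induced h t) = u (mult_map t).
Proof.
move=> ph; apply: tensor_elim => [|t t' IHt IHt'|a m].
- by rewrite induced0 // !linear0.
- by rewrite inducedD // !linearD IHt IHt'.
- by rewrite induced_pure // linearZ /= ph mult_map_pure linearZ.
Qed.

(** Extend [h \o u] to A (x)_B P by adjunction and precompose with the section of the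
    multiplication. Only [d (h (u x)) = u x] is asked, and not [d \o h = id], because a contraction
    inverts the differential on cycles only. *)
Lemma rel_projective_lift P (Y Z : lmodType A) (u : {linear P -> Y}) (h : Y -> Z) (d : {linear Z -> Y}) :
    rel_projective B P -> sub_linear B h -> (forall x, d (h (u x)) = u x) ->
  exists v : {linear P -> Z}, forall x, d (v x) = u x.
Proof.
move=> [sec secK] hB dhu.
have huB : sub_linear B (h \o u).
  split=> [x y|b x Bb] /=; first by rewrite linearD (proj1 hB).
  by rewrite linearZ /= (proj2 hB).
have [w wE] := induced_as_linear huB.
by exists (w \o sec) => x /=; rewrite wE (induced_mult huB dhu) secK.
Qed.

Lemma fin_gen_intro M (I : finType) (s : I -> M) :
  (forall x, exists c : I -> A, x = \sum_i c i *: s i) -> fin_gen M.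
Proof.
move=> s_gen; exists (codom s) => x; have [c ->] := s_gen x.
have szE : size (codom s) = #|I| by rewrite size_codom.
exists (fun i => c (enum_val (cast_ord szE i))).
rewrite (reindex (fun i => enum_val (cast_ord szE i))) /=; last first.
  exists (fun x => cast_ord (esym szE) (enum_rank x)) => i _.
    by rewrite enum_valK cast_ordK.
  by rewrite cast_ordKV enum_rankK.
apply: eq_bigr => i _; congr (_ *: _).
rewrite (nth_map (enum_val (cast_ord szE i))); last by rewrite -cardE -szE.
by congr (s _); apply: enum_val_nth.
Qed.

Lemma fin_gen_scalar M : fin_gen M -> exists (I : finType) (s : I -> M),
  forall x, exists c : I -> K, x = \sum_i (c i)%:A *: s i.
Proof.
move=> [s s_gen]; set n := \dim (fullv : {vspace A}).
exists ('I_(size s) * 'I_n)%type, (fun p : 'I_(size s) * 'I_n => (vbasis fullv)`_p.2 *: s`_p.1) => x.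
have [c ->] := s_gen x; exists (fun p : 'I_(size s) * 'I_n => coord (vbasis fullv) p.2 (c p.1)).
rewrite -(pair_bigA _ (fun i j =>
  (coord (vbasis fullv) j (c i))%:A *: ((vbasis fullv)`_j *: s`_i))) /=.
apply: eq_bigr => i _; rewrite {1}(coord_vbasis (memvf (c i))) scaler_suml.
by apply: eq_bigr => j _; rewrite scalarE.
Qed.

Lemma tensor_fin_gen M : fin_gen M -> fin_gen (tensor B M).
Proof.
move=> /fin_gen_scalar[I [s s_gen]]; apply: (fin_gen_intro (s := fun i => pure B 1 (s i))).
apply: tensor_elim => [|_ _ [c ->] [c' ->]|a m].
- by exists (fun=> 0); rewrite big1 // => i _; rewrite scale0r.
- exists (fun i => c i + c' i); rewrite -big_split; apply: eq_bigr => i _.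
  by rewrite scalerDl.
- have [c ->] := s_gen m; exists (fun i => c i *: a).
  rewrite pure_sumr; apply: eq_bigr => i _.
  by rewrite -pure_scalar scale_pure mulr1.
Qed.

End TensorTheory.

Section RelativeTheory.

Variables (K : fieldType) (A : falgType K) (B : {aspace A}).
Hypothesis B1 : 1 \in B.
Implicit Types M N P : lmodType A.

(** * Relative syzygies and splicing of resolutions *)

Section Syzygy.

Variables (P M : lmodType A) (p : {linear P -> M}) (s : M -> P).
Hypotheses (sB : sub_linear B s) (ps : forall x, p (s x) = x).

Fact syzygy_proj_subproof x : in_kernel p (x - s (p x)).
Proof. by rewrite /in_kernel linearB /= ps subrr. Qed.

Definition syzygy_proj x : kernel p := Sub (x - s (p x)) (syzygy_proj_subproof x).

Lemma val_syzygy_proj x : val (syzygy_proj x) = x - s (p x).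
Proof. by rewrite SubK. Qed.

Lemma syzygy_projK k : syzygy_proj (val k) = k.
Proof.
by apply: val_inj; rewrite val_syzygy_proj kernelP (sub_linear0 sB) subr0.
Qed.

Lemma syzygy_proj_sub_linear : sub_linear B syzygy_proj.
Proof.
split=> [x y|b x Bb]; apply: val_inj.
  by rewrite kernel_valD !val_syzygy_proj linearD (proj1 sB) opprD addrACA.
by rewrite kernel_valZ !val_syzygy_proj linearZ (proj2 sB) // scalerBr.
Qed.

(** The projection onto the kernel is only B-linear, so it need not carry A-generators to
    A-generators; it does carry a finite spanning set over the scalars to one. *)
Lemma syzygy_fin_gen : fin_gen P -> fin_gen (kernel p).
Proof.
move=> /fin_gen_scalar[I [q q_gen]].
apply: (fin_gen_intro (s := fun i => syzygy_proj (q i))) => k.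
have [c vk] := q_gen (val k); exists (fun i => (c i)%:A).
rewrite -[LHS]syzygy_projK vk (sub_linear_sum syzygy_proj_sub_linear).
by apply: eq_bigr => i _; rewrite (proj2 syzygy_proj_sub_linear) // scalar_in.
Qed.

End Syzygy.

(** An inductive form of the bound on the relative dimension, one cover at a time; complexes enter
    only in [rel_dim_resolution]. *)
Fixpoint rel_dim_le (m : nat) (M : lmodType A) : Prop :=
  if m is m'.+1 then
    exists (P : lmodType A) (p : {linear P -> M}) (s : M -> P),
      [/\ fin_gen P, rel_projective B P, sub_linear B s,
          forall x, p (s x) = x & rel_dim_le m' (kernel p)]
  else fin_gen M /\ rel_projective B M.

Lemma projective_resolution M :
  fin_gen M -> rel_projective B M -> rel_resolution B M 0.
Proof.
(* The kernel of the identity serves as the zero module. *)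
move=> fgM prM; pose Z : lmodType A := kernel (idfun : {linear M -> M}).
have Z0 (x : Z) : x = 0 by apply: val_inj; apply: (kernelP x).
pose P (i : nat) : lmodType A := if i is 0%N then M else Z.
pose d i : {linear augmented M P i.+1 -> augmented M P i} :=
  match i return {linear augmented M P i.+1 -> augmented M P i} with
  | 0%N => (idfun : {linear M -> M})
  | i'.+1 => \0
  end.
pose h i : augmented M P i -> augmented M P i.+1 :=
  match i return augmented M P i -> augmented M P i.+1 with
  | 0%N => id
  | i'.+1 => fun=> 0
  end.
exists P, d; split.
- split=> [[|i] x|] //.
  exists h; split=> // [[|i]|[|i] x] //.
  + by split=> [x y|b x _] /=; rewrite ?addr0 ?scaler0.
  + by rewrite /= add0r.
  + exact: etrans (Z0 _) (esym (Z0 x)).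
- case=> [|i] //; exists [::] => x; exists (fun=> 0).
  by rewrite big_ord0; apply: Z0.
- case=> [|i] //; exists (\0 : {linear Z -> tensor B Z}) => x.
  by rewrite linear0 (Z0 x).
- by case=> // i _ x; apply: Z0.
Qed.

Lemma splice_resolution M P (p : {linear P -> M}) (s : M -> P) m :
    sub_linear B s -> (forall x, p (s x) = x) -> fin_gen P -> rel_projective B P ->
  rel_resolution B (kernel p) m -> rel_resolution B M m.+1.
Proof.
move=> sB ps fgP prP [Q [d [[dd [h [hB dh0 dh]]] fgQ prQ Q0]]].
pose P' (i : nat) : lmodType A := if i is j.+1 then Q j else P.
pose d' i : {linear augmented M P' i.+1 -> augmented M P' i} :=
  match i return {linear augmented M P' i.+1 -> augmented M P' i} with
  | 0%N => p
  | 1%N => \val \o d 0%N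
  | j.+2 => d j.+1
  end.
(* In degree 1 an element of [P] is first projected to the kernel along the B-linear section [s],
   and then contracted. *)
pose h' i : augmented M P' i -> augmented M P' i.+1 :=
  match i return augmented M P' i -> augmented M P' i.+1 with
  | 0%N => s
  | 1%N => fun x => h 0%N (syzygy_proj ps x)
  | j.+2 => h j.+1
  end.
have projB := syzygy_proj_sub_linear sB ps.
exists P', d'; split.
- split=> [[|[|i]] x|] /=.
  + exact: (kernelP (d 0%N x)).
  + by rewrite [d 0%N _](dd 0%N).
  + exact: (dd i.+1 x).
  exists h'; split=> // [[|[|i]]|[|[|i]] x] //.
  + split=> [x y|b x Bb] /=; first by rewrite (proj1 projB) (proj1 (hB _)).
    by rewrite (proj2 projB) // (proj2 (hB _)).
  + exact: (hB i.+1).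
  + by rewrite /= dh0 val_syzygy_proj subrK.
  + apply: etrans (dh 0%N x).
    by congr (_ + h 0%N _); apply: (syzygy_projK sB ps).
  + exact: (dh i.+1 x).
- by case.
- by case.
- by case=> // i im; apply: Q0.
Qed.

Lemma rel_dim_resolution m M : rel_dim_le m M -> rel_resolution B M m.
Proof.
elim: m M => [|m IHm] M /=; first by case; apply: projective_resolution.
by move=> [P [p [s [fgP prP sB ps /IHm]]]]; apply: splice_resolution ps _ _.
Qed.

(** * Tensoring over an intermediate subalgebra *)

Section LargerSubalgebra.

Variables (B' : {aspace A}) (M : lmodType A).
Hypothesis sBB' : (B <= B')%VS.

Let B'1 : 1 \in B'. Proof. exact: subvP sBB' _ B1. Qed.

Definition relsyz : lmodType A := kernel (mult_map (B := B') (M := M)).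

Definition relsyz_val (k : relsyz) : tensor B' M := val k.

Lemma relsyz_val_inj : injective relsyz_val.
Proof. exact: val_inj. Qed.

Lemma relsyz_valD k l : relsyz_val (k + l) = relsyz_val k + relsyz_val l.
Proof. exact: kernel_valD. Qed.

Lemma relsyz_valZ x k : relsyz_val (x *: k) = x *: relsyz_val k.
Proof. exact: kernel_valZ. Qed.

Lemma relsyz_mult k : mult_map (relsyz_val k) = 0.
Proof. exact: kernelP. Qed.

Lemma relsyz_intro t : mult_map t = 0 -> exists k, relsyz_val k = t.
Proof. exact: (@kernel_intro A _ _ (mult_map (B := B') (M := M))). Qed.

(** By adjunction over B', a section of the multiplication A (x)_B (A (x)_B' M) -> A (x)_B' M is
    determined by its values at the 1 (x) m, and these may be any B'-linear choice of preimages. *)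
Lemma tensor_rel_projective (h : M -> tensor B (tensor B' M)) :
    sub_linear B' h -> (forall m, mult_map (h m) = pure B' 1 m) ->
  rel_projective B (tensor B' M).
Proof.
move=> hB' mh; have [w wE] := induced_as_linear hB'.
exists w; apply: tensor_elim => [|t u IHt IHu|a m].
- by rewrite !linear0.
- by rewrite !linearD; apply: (f_equal2 +%R IHt IHu).
- by rewrite wE induced_pure // linearZ /= mh scale_pure mulr1.
Qed.

(** The map sending m to 1 (x) m is a B'-linear, hence B-linear, section of the multiplication, so A
    (x)_B' M may start a resolution relative to the smaller algebra B. *)
Lemma relsyz_rel_dim m :
    fin_gen M -> rel_projective B (tensor B' M) -> rel_dim_le m relsyz ->
  rel_dim_le m.+1 M.
Proof.
move=> fgM prT dimS.
exists (tensor B' M), (mult_map (B := B') (M := M)), (pure B' 1); split=> //.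
- exact: tensor_fin_gen.
- have [pD pZ] := pure1_sub_linear B' M.
  by split=> // b x Bb; apply/pZ/(subvP sBB').
- by move=> x; apply: etrans (mult_map_pure _ _ _) (scale1r x).
Qed.

Lemma relsyz_fin_gen : fin_gen M -> fin_gen relsyz.
Proof.
move=> fgM; apply: (syzygy_fin_gen (s := pure B' 1)).
- have [pD pZ] := pure1_sub_linear B' M.
  by split=> // b x Bb; apply/pZ/(subvP sBB').
- by move=> x; apply: etrans (mult_map_pure _ _ _) (scale1r x).
- exact: tensor_fin_gen.
Qed.

End LargerSubalgebra.

Lemma tensor_projective M : rel_projective B (tensor B M).
Proof.
apply: (tensor_rel_projective (h := fun m => pure B 1 (pure B 1 m))) => [|m].
  have [D1 Z1] := pure1_sub_linear B M.
  have [D2 Z2] := pure1_sub_linear B (tensor B M).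
  by split=> [x y|b x Bb]; [rewrite D1 D2 | rewrite Z1 // Z2].
by rewrite mult_map_pure scale1r.
Qed.

(** * Comparison maps and homotopies in bounded degrees *)

Section Comparison.

Variables (X Y : nat -> lmodType A).
Variables (dX : forall i, {linear X i.+1 -> X i}) (dY : forall i, {linear Y i.+1 -> Y i}).
Variables (hY : forall i, Y i -> Y i.+1) (n : nat).
Hypothesis dXX : forall i x, dX i (dX i.+1 x) = 0.
Hypothesis hYB : forall i, (i < n)%N -> sub_linear B (@hY i).
Hypothesis dhY0 : forall x, (0 < n)%N -> dY 0%N (hY x) = x.
Hypothesis dhY : forall i x, (i.+1 < n)%N -> dY i.+1 (hY x) + hY (dY i x) = x.

Lemma contraction_cycle i (y : Y i.+1) : (i.+1 < n)%N ->
  dY i y = 0 -> dY i.+1 (hY y) = y.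
Proof.
move=> lt_in dy; rewrite -[RHS](dhY y lt_in) dy.
by rewrite (sub_linear0 (hYB (ltnW lt_in))) addr0.
Qed.

Lemma chain_lift (f0 : {linear X 0%N -> Y 0%N}) :
    (forall i, (i < n)%N -> rel_projective B (X i.+1)) ->
  exists f : forall i, {linear X i -> Y i}, (forall x, f 0%N x = f0 x) /\
    forall i, (i < n)%N -> forall x, dY i (f i.+1 x) = f i (dX i x).
Proof.
(* The zero map is the fallback when the lifting condition fails, so that [nat_rect] iterates the
   step through all degrees; that the condition holds is proved afterwards by induction. The same
   device serves in [null_homotopy]. *)
move=> prX; have step i (f : {linear X i -> Y i}) : exists g : {linear X i.+1 -> Y i.+1},
    (i < n)%N -> (forall x, dY i (hY (f (dX i x))) = f (dX i x)) ->
    forall x, dY i (g x) = f (dX i x).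
  case: (boolP (i < n)%N) => [lt_in|_]; last by exists \0.
  case: (pselect (forall x, dY i (hY (f (dX i x))) = f (dX i x))) => [dhf|nd].
    have [g dg] := rel_projective_lift (u := f \o dX i) (prX _ lt_in) (hYB lt_in) dhf.
    by exists g.
  by exists \0 => _ /nd.
pose f := nat_rect (fun i => {linear X i -> Y i}) f0
  (fun i fi => projT1 (cid (step i fi))).
have fS i : f i.+1 = projT1 (cid (step i (f i))) by [].
exists f; split=> //; elim=> [|i IHi] lt_in x; rewrite fS.
  by case: cid => g /= -> // y; rewrite dhY0.
case: cid => g /= -> // y; apply: contraction_cycle => //.
by rewrite IHi ?(ltnW lt_in) // dXX linear0.
Qed.

Lemma null_homotopy (g : forall i, {linear X i -> Y i}) :
    (forall x, g 0%N x = 0) ->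
    (forall i, (i.+1 < n)%N -> forall x, dY i (g i.+1 x) = g i (dX i x)) ->
    (forall i, (i.+1 < n)%N -> rel_projective B (X i.+1)) ->
  exists s : forall i, {linear X i -> Y i.+1}, forall i, (i.+1 < n)%N ->
    forall x, g i.+1 x = dY i.+1 (s i.+1 x) + s i (dX i x).
Proof.
move=> g0 dg prX.
have step i (s : {linear X i -> Y i.+1}) : exists t : {linear X i.+1 -> Y i.+2},
    (i.+1 < n)%N -> (forall x, dY i (g i.+1 x - s (dX i x)) = 0) ->
    forall x, g i.+1 x = dY i.+1 (t x) + s (dX i x).
  case: (boolP (i.+1 < n)%N) => [lt_in|_]; last by exists \0.
  case: (pselect (forall x, dY i (g i.+1 x - s (dX i x)) = 0)) => [du|nd]; last first.
    by exists \0 => _ /nd.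
  have dhu x : dY i.+1 (hY ((g i.+1 \- (s \o dX i)) x)) = (g i.+1 \- (s \o dX i)) x.
    exact: (contraction_cycle lt_in (du x)).
  have [t dt] := rel_projective_lift (prX _ lt_in) (hYB lt_in) dhu.
  by exists t => _ _ x; rewrite dt /= subrK.
pose s := nat_rect (fun i => {linear X i -> Y i.+1}) \0
  (fun i si => projT1 (cid (step i si))).
have sS i : s i.+1 = projT1 (cid (step i (s i))) by [].
exists s; elim=> [|i IHi] lt_in x.
  rewrite sS; case: cid => t /= -> // y.
  by rewrite subr0 dg ?g0.
rewrite sS; case: cid => t /= -> // y.
rewrite linearB /= dg // IHi ?(ltnW lt_in) //.
by rewrite dXX linear0 addr0 subrr.
Qed.

End Comparison.

(** Compare [X] with the short resolution in both directions. The identity minus the round trip is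
    null-homotopic up to degree n, and the round trip kills boundaries in degree n, where the
    homotopy formula becomes d s d = d. The hypotheses stop at degree n since the zigzag complex is
    contractible with projective terms only that far. *)
Lemma short_resolution_split (X : nat -> lmodType A)
    (d : forall i, {linear X i.+1 -> X i}) (h : forall i, X i -> X i.+1) n m :
    (forall i x, d i (d i.+1 x) = 0) ->
    (forall i, (i <= n)%N -> sub_linear B (h i)) ->
    (forall x, d 0%N (h 0%N x) = x) ->
    (forall i x, (i.+1 <= n)%N -> d i.+1 (h i.+1 x) + h i (d i x) = x) ->
    (forall i, (i < n)%N -> rel_projective B (X i.+1)) ->
    rel_resolution B (X 0%N) m -> (m < n)%N ->
  exists s : {linear X n -> X n.+1}, forall x, d n (s (d n x)) = d n x.
Proof.
move=> dd hB dh0 dh prX [P [e [[ee [k [kB ek0 ek]]] _ prP P0]]] lt_mn.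
case: n => // n in hB dh prX lt_mn *.
have [psi [psi0 psid]] := chain_lift (n := n.+1) dd (fun i _ => kB i)
  (fun x _ => ek0 x) (fun i x _ => ek i x) (idfun : {linear X 0%N -> _}) prX.
have [phi [phi0 phid]] := chain_lift (n := n.+1) ee (fun i li => hB i (ltnW li))
  (fun x _ => dh0 x) (fun i x li => dh i x (ltnW li))
  (idfun : {linear augmented (X 0%N) P 0%N -> X 0%N}) (fun i _ => prP i).
pose g i : {linear X i -> X i} := idfun \- (phi i \o psi i).
have g0 x : g 0%N x = 0 by rewrite /g /= phi0 psi0 /= subrr.
have dg i : (i.+1 < n.+2)%N -> forall x, d i (g i.+1 x) = g i (d i x).
  by move=> lt_in x; rewrite /g /= linearB /= phid // psid.
have [s gE] := null_homotopy (n := n.+2) dd hB dh g0 dg prX.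
exists (s n.+1) => x.
(* Here [n] is one less than in the statement, so [P n] may be nonzero; but a cycle in it is a
   boundary from [P n.+1], which vanishes. *)
have psi_d0 : psi n.+1 (d n.+1 x) = 0.
  rewrite -[LHS]ek psid // dd linear0 (sub_linear0 (kB _)) addr0.
  by rewrite [k _ _]P0 ?linear0.
have := gE n (ltnSn _) (d n.+1 x); rewrite dd linear0 addr0 => <-.
by rewrite /g /= psi_d0 linear0 subr0.
Qed.

Lemma le_infP (S : nat -> Prop) m : le_inf (inf_nat S) m <-> exists2 i, (i <= m)%N & S i.
Proof.
rewrite /inf_nat; case: pselect => [S_ex|nS] /=; last first.
  by split=> // -[i _ Si]; case: nS; exists i; apply/asboolP.
case: ex_minnP => i /asboolP Si i_min; split=> [im|[j jm Sj]]; first by exists i.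
by apply: leq_trans jm; apply/i_min/asboolP.
Qed.

Lemma inf_natE (S : nat -> Prop) m :
  S m -> (forall i, S i -> (m <= i)%N) -> inf_nat S = Some m.
Proof.
move=> Sm m_min; rewrite /inf_nat; case: pselect => [S_ex|[]]; last first.
  by exists m; apply/asboolP.
case: ex_minnP => i /asboolP Si i_min; congr Some; apply/eqP.
by rewrite eqn_leq m_min // i_min //; apply/asboolP.
Qed.

End RelativeTheory.

(** * The zigzag algebra *)

(** Closed form of the arrow list, suited to [lia]: consecutive columns are completely joined,
    except that 2k + 1 -> 2k + 3 is missing for k >= 1. *)
Definition zigzag_edge (a b : nat) : bool :=
  (b./2 == a./2.+1) && ~~ [&& odd a, odd b & a != 1%N].

Lemma mem_zigzag_list n a b : (0 < a)%N -> (a <= n.+2)%N ->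
  ((a, b) \in zigzag_list n) = zigzag_edge a b.
Proof.
move=> a_gt0 a_le; rewrite /zigzag_list mem_cat !inE !xpair_eqE /zigzag_edge.
apply/idP/idP => [/orP[|/flattenP[s /mapP[k]]]|].
- by case/orP=> /andP[/eqP-> /eqP->].
- rewrite mem_iota => k_ge ->; rewrite !inE !xpair_eqE.
  by case/or3P=> /andP[/eqP-> /eqP->]; lia.
- case/andP=> /eqP ba nab; case: (ltngtP a 1%N) => [|a_gt1|a1]; first lia.
    apply/orP; right; apply/flattenP; eexists.
      by apply: map_f; instantiate (1 := a./2); rewrite mem_iota; lia.
    by rewrite !inE !xpair_eqE; lia.
  by lia.
Qed.

Section Zigzag.

Variables (K : fieldType) (n : nat).

Local Notation A := (zigzag_alg K n).
Local Notation B := (zigzag_subalg K n).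
Local Notation Q := (zigzag n).
Local Notation V := 'I_n.+2.
Local Notation e := (@videm K n.+1 Q).
Local Notation f := (column_idem K n).
Local Notation c := (n.+2)./2.

Lemma arrow_edge (x : arrow Q) : zigzag_edge (label (src x)) (label (tgt x)).
Proof.
rewrite -(@mem_zigzag_list n) //; first exact: (valP x).
exact: ltn_ord.
Qed.

Lemma column_tgt (x : arrow Q) : column (tgt x) = (column (src x)).+1.
Proof. by have /andP[/eqP] := arrow_edge x. Qed.

Lemma arrow_inj (x y : arrow Q) : src x = src y -> tgt x = tgt y -> x = y.
Proof.
move=> xy1 xy2; apply: val_inj; move: xy1 xy2 => /=.
by case: (val x) (val y) => [? ?] [? ?] /= -> ->.
Qed.

Lemma edge_arrow (u v : V) :
  zigzag_edge (label u) (label v) -> exists x : arrow Q, src x = u /\ tgt x = v.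
Proof.
rewrite -(@mem_zigzag_list n) //; last exact: ltn_ord.
by move=> uv; exists (exist _ (u, v) uv).
Qed.

Lemma column_le (v : V) : (column v <= c)%N.
Proof. by rewrite /column /label; have := ltn_ord v; lia. Qed.

Lemma label_inj : injective (@label n).
Proof. by move=> u v [uv]; apply: val_inj. Qed.

Lemma vertex_of_label l : (0 < l)%N -> (l <= n.+2)%N -> exists v : V, label v = l.
Proof.
case: l => // l _ l_le; exists (Ordinal (l_le : (l < n.+2)%N)).
by [].
Qed.

(** The generators [column_arrows K n i] are the products a f_i, so compatibility with B amounts to
    compatibility with scalars, the column idempotents and this single element. *)
Definition total_arrow : A := \sum_(x : arrow Q) varrow K x.
Local Notation a := total_arrow.

Lemma videm_column v i : e v * f i = if column v == i then e v else 0.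
Proof.
rewrite /column_idem mulr_sumr; case: eqP => [<-|ne].
  rewrite (bigD1 v) //= videmM eqxx big1 ?addr0 // => u /andP[_ /negPf uv].
  by rewrite videmM eq_sym uv.
rewrite big1 // => u /eqP cu; rewrite videmM; case: eqP => // uv.
by case: ne; rewrite uv.
Qed.

Lemma column_videm v i : f i * e v = if column v == i then e v else 0.
Proof.
rewrite /column_idem mulr_suml; case: eqP => [<-|ne].
  rewrite (bigD1 v) //= videmM eqxx big1 ?addr0 // => u /andP[_ /negPf uv].
  by rewrite videmM uv.
rewrite big1 // => u /eqP cu; rewrite videmM; case: eqP => // uv.
by case: ne; rewrite -uv.
Qed.

Lemma column_arrow x i : f i * varrow K x = if column (tgt x) == i then varrow K x else 0.
Proof.
rewrite /column_idem mulr_suml; case: eqP => [<-|ne].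
  rewrite (bigD1 (tgt x)) //= videm_arrow eqxx big1 ?addr0 // => u /andP[_ /negPf uv].
  by rewrite videm_arrow eq_sym uv.
rewrite big1 // => u /eqP cu; rewrite videm_arrow; case: eqP => // uv.
by case: ne; rewrite uv.
Qed.

Lemma arrow_column x i : varrow K x * f i = if column (src x) == i then varrow K x else 0.
Proof.
rewrite /column_idem mulr_sumr; case: eqP => [<-|ne].
  rewrite (bigD1 (src x)) //= varrow_idem eqxx big1 ?addr0 // => u /andP[_ /negPf uv].
  by rewrite varrow_idem eq_sym uv.
rewrite big1 // => u /eqP cu; rewrite varrow_idem; case: eqP => // uv.
by case: ne; rewrite uv.
Qed.

Lemma columnM i j : f i * f j = if i == j then f i else 0.
Proof.
rewrite {1}/column_idem mulr_suml.
rewrite (eq_bigr (fun v => if i == j then e v else 0)) => [|v /eqP <-]; last exact: videm_column.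
by case: ifP => // _; rewrite big1.
Qed.

Lemma sum_column : \sum_(i < c.+1) f i = 1.
Proof.
rewrite radsq_oneE [RHS](partition_big (fun v : V => inord (column v) : 'I_c.+1) predT) //=.
apply: eq_bigr => i _; apply: eq_bigl => v.
by rewrite -val_eqE /= inordK // ltnS column_le.
Qed.

Lemma total_arrow_sq : a * a = 0.
Proof.
rewrite /total_arrow mulr_suml big1 // => x _.
by rewrite mulr_sumr big1 // => y _; rewrite varrowM.
Qed.

Lemma column_total i : f i.+1 * a = a * f i.
Proof.
rewrite /total_arrow [RHS]mulr_suml [LHS]mulr_sumr; apply: eq_bigr => x _.
by rewrite column_arrow arrow_column column_tgt eqSS.
Qed.

Lemma column0_total : f 0%N * a = 0.
Proof.
by rewrite /total_arrow mulr_sumr big1 // => x _; rewrite column_arrow column_tgt.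
Qed.

Lemma column_arrowsE i : column_arrows K n i = a * f i.
Proof.
rewrite /total_arrow mulr_suml /column_arrows [LHS]big_mkcond; apply: eq_bigr => x _.
by rewrite arrow_column column_tgt eqSS andbb; case: ifP.
Qed.

Lemma column_out i : (c < i)%N -> f i = 0.
Proof.
move=> lt_ci; rewrite /column_idem big_pred0 // => v.
by have := column_le v; case: eqP => //; lia.
Qed.

(** There are no parallel arrows, so cutting the total arrow at both ends isolates a single one. *)
Lemma videm_total v w (x : arrow Q) : src x = v -> tgt x = w ->
  e w * a * e v = varrow K x.
Proof.
move=> xv xw; have E y : e w * varrow K y * e v = if y == x then varrow K y else 0.
  rewrite (videm_arrow K w y); case: (eqVneq (tgt y) w) => [yw|yw].
    rewrite (varrow_idem K v y); case: (eqVneq (src y) v) => [yv|yv].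
      by rewrite (@arrow_inj y x) ?eqxx // ?xv ?xw.
    by case: eqP => // yx; rewrite yx xv eqxx in yv.
  by rewrite mul0r; case: eqP => // yx; rewrite yx xw eqxx in yw.
rewrite /total_arrow mulr_sumr mulr_suml (eq_bigr _ (fun y _ => E y)).
by rewrite -big_mkcond big_pred1_eq.
Qed.

Lemma total_videm_total v : a * e v * a = 0.
Proof.
rewrite /total_arrow !mulr_suml big1 // => x _; rewrite mulr_sumr big1 // => y _.
by rewrite (varrow_idem K v x); case: eqP => _; rewrite ?varrowM ?mul0r.
Qed.

Lemma total_videmE v : a * e v = \sum_(x : arrow Q | src x == v) varrow K x.
Proof.
rewrite /total_arrow mulr_suml [RHS]big_mkcond; apply: eq_bigr => x _.
exact: varrow_idem.
Qed.

Lemma varrowE (x : arrow Q) : varrow K x = e (tgt x) * a * e (src x).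
Proof. exact/esym/videm_total. Qed.

Lemma videm_total0 v w : ~~ zigzag_edge (label v) (label w) -> e w * a * e v = 0.
Proof.
move=> nvw; rewrite /total_arrow mulr_sumr mulr_suml big1 // => x _.
rewrite (videm_arrow K w x); case: eqP => [xw|_]; last by rewrite mul0r.
rewrite (varrow_idem K v x); case: eqP => [xv|//].
by have := arrow_edge x; rewrite xv xw (negPf nvw).
Qed.

Definition zigzag_gens : seq A :=
  [seq f i | i <- iota 0 c.+1] ++ [seq column_arrows K n i | i <- iota 0 c].

Lemma column_in i : f i \in B.
Proof.
case: (ltnP c i) => [/column_out->|le_ic]; first exact: mem0v.
apply/(subvP (sub_agenv _))/memv_span; rewrite mem_cat map_f //.
by rewrite mem_iota; lia.
Qed.

Lemma total_in : a \in B.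
Proof.
rewrite -[a]mulr1 -sum_column mulr_sumr memv_suml // => i _.
rewrite -column_arrowsE; case: (ltnP i c) => [lt_ic|le_ci]; last first.
  suff -> : column_arrows K n i = 0 by exact: mem0v.
  by rewrite column_arrowsE -column_total column_out ?mul0r.
apply/(subvP (sub_agenv _))/memv_span; rewrite mem_cat; apply/orP; right.
by apply: map_f; rewrite mem_iota.
Qed.

Definition column_split (s : nat) : {aspace A} :=
  <<<<zigzag_gens ++ [seq e v | v <- enum 'I_n.+2 & column v == s]>>>>%AS.

Lemma sub_column_split s : (B <= column_split s)%VS.
Proof. by apply: agenvS; rewrite [X in (_ <= X)%VS]span_cat addvSl. Qed.

Lemma videm_in_split v : e v \in column_split (column v).
Proof.
apply/(subvP (sub_agenv _))/memv_span; rewrite mem_cat; apply/orP; right.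
by apply: map_f; rewrite mem_filter eqxx mem_enum.
Qed.

End Zigzag.

(** * Modules supported on a final segment of columns *)

Section ZigzagModules.

Variables (K : fieldType) (n : nat).

Local Notation A := (zigzag_alg K n).
Local Notation B := (zigzag_subalg K n).
Local Notation Q := (zigzag n).
Local Notation V := 'I_n.+2.
Local Notation e := (@videm K n.+1 Q).
Local Notation f := (column_idem K n).
Local Notation c := (n.+2)./2.
Local Notation a := (total_arrow K n).
Local Notation B1 := (zigzag_subalg1 K n).

Implicit Types M N : lmodType A.

Lemma videm_columnZ M v (m : M) : e v *: (f (column v) *: m) = e v *: m.
Proof. by rewrite scalerA videm_column eqxx. Qed.

Lemma column_videmZ M v (m : M) : f (column v) *: (e v *: m) = e v *: m.
Proof. by rewrite scalerA column_videm eqxx. Qed.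

Section Commute.

Variables (M N : lmodType A) (h : M -> N).
Hypotheses (hD : {morph h : x y / x + y}).
Hypothesis hK : forall k x, h (k%:A *: x) = k%:A *: h x.
Hypothesis hf : forall i x, h (f i *: x) = f i *: h x.
Hypothesis ha : forall x, h (a *: x) = a *: h x.

Let comm (b : A) : Prop := forall x, h (b *: x) = b *: h x.

Lemma comm_gens (s : seq A) : (forall b, b \in s -> comm b) ->
  forall b, b \in agenv <<zigzag_gens K n ++ s>> -> comm b.
Proof.
move=> hs; apply: agenv_span_ind => [x|k b b' Pb Pb' x|b b' Pb Pb' x|b].
- by rewrite !scale1r.
- by rewrite !scalerDl hD (scalarE k b x) (scalarE k b (h x)) hK Pb Pb'.
- by rewrite -!scalerA Pb Pb'.
rewrite !mem_cat -orbA => /or3P[/mapP[i _ ->]|/mapP[i _ ->]|/hs //] x.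
  exact: hf.
by rewrite column_arrowsE -!scalerA ha hf.
Qed.

Lemma gens_sub_linear : sub_linear B h.
Proof.
by have := @comm_gens [::]; rewrite cats0 => C; split=> // b x Bb; apply: C.
Qed.

Lemma split_sub_linear s :
    (forall v x, column v == s -> h (e v *: x) = e v *: h x) ->
  sub_linear (column_split K n s) h.
Proof.
move=> he; have C := @comm_gens [seq e v | v <- enum V & column v == s].
split=> // b x Bb; apply: (C _ b Bb x) => b' /mapP[v].
by rewrite mem_filter => /andP[cv _] -> y; apply: he.
Qed.

End Commute.

(** Every arrow is e_w a e_v with a in B, so B and the vertex idempotents generate A. *)
Lemma vertex_linear M N (h : M -> N) : sub_linear B h ->
  (forall v x, h (e v *: x) = e v *: h x) -> linear h.
Proof.
move=> hB he b x y; rewrite (proj1 hB); congr (_ + _).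
have hK k z : h (k%:A *: z) = k%:A *: h z by rewrite (proj2 hB) ?scalar_in ?B1.
rewrite [b]radsq_basis !scalerDl (proj1 hB) !scaler_suml !(sub_linear_sum hB).
congr (_ + _); apply: eq_bigr => i _.
  by rewrite (scalarE _ (e i) x) (scalarE _ (e i) (h x)) hK he.
rewrite (scalarE _ (varrow K i) x) (scalarE _ (varrow K i) (h x)) hK; congr (_ *: _).
by rewrite varrowE -!scalerA !he (proj2 hB) ?total_in // he.
Qed.

(** Expand the left factor in the path basis, then move the idempotent of the starting column across
    the tensor sign: what remains is a path tensored with an element of that column. *)
Lemma tensor_path_ind (B' : {aspace A}) M (P : tensor B' M -> Prop) :
    (B <= B')%VS ->
    P 0 -> (forall t u, P t -> P u -> P (t + u)) ->
    (forall v m, f (column v) *: m = m -> P (pure B' (e v) m)) ->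
    (forall x m, f (column (src x)) *: m = m -> P (pure B' (varrow K x) m)) ->
  forall t, P t.
Proof.
move=> /subvP sBB' P0 PD Pe Px; apply: tensor_elim => // b m.
have B'1 : 1 \in B' by apply/sBB'/B1.
rewrite [b]radsq_basis pureDl !pure_suml.
apply: (PD _ _); apply: big_ind => // i _; rewrite pure_scalar //; set m' := _ *: m.
  rewrite -(mulr1 (e i)).
  have -> : pure B' (e i * 1) m' = pure B' (e i) (f (column i) *: m').
    by rewrite mulr1 -pure_bal ?videm_column ?eqxx // sBB' ?column_in.
  by apply: Pe; rewrite scalerA columnM eqxx.
have -> : pure B' (varrow K i) m' = pure B' (varrow K i) (f (column (src i)) *: m').
  by rewrite -pure_bal ?arrow_column ?eqxx // sBB' ?column_in.
by apply: Px; rewrite scalerA columnM eqxx.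
Qed.

Definition column_supported s M : Prop := forall i, (i < s)%N -> forall m : M, f i *: m = 0.

Lemma tensor_supported (B' : {aspace A}) s M : (B <= B')%VS ->
  column_supported s M -> column_supported s (tensor B' M).
Proof.
move=> sBB' supM i lt_is; apply: tensor_path_ind => // [|t u Pt Pu|v m mE|x m mE].
- by rewrite scaler0.
- by rewrite scalerDr Pt Pu addr0.
- rewrite scale_pure column_videm; case: eqP => [cv|_]; last by rewrite pure0l.
  by rewrite -mE supM ?pure0r ?cv.
- rewrite scale_pure column_arrow column_tgt; case: eqP => [cv|_]; last by rewrite pure0l.
  by rewrite -mE supM ?pure0r // (leq_trans _ lt_is) // -cv.
Qed.

(** An arrow into column s starts in column s - 1, where M vanishes. Only the e_v (x) m with v in
    V_s survive, and e_v moves across because it lies in B'. *)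
Lemma tensor_bottom (B' : {aspace A}) s M : (B <= B')%VS -> column_supported s M ->
    (forall v, column v = s -> e v \in B') ->
  forall t : tensor B' M, exists m, f s *: t = pure B' 1 m.
Proof.
move=> sBB' supM eB'; apply: tensor_path_ind => // [|t u [m tE] [m' uE]|v m mE|x m mE].
- by exists 0; rewrite scaler0 pure0r.
- by exists (m + m'); rewrite scalerDr tE uE pureDr.
- rewrite scale_pure column_videm; case: eqP => [cv|_]; last by exists 0; rewrite pure0l pure0r.
  by exists (e v *: m); rewrite -pure_bal ?mul1r // eB'.
- exists 0; rewrite scale_pure column_arrow column_tgt pure0r.
  case: eqP => [cv|_]; last by rewrite pure0l.
  by rewrite -mE supM ?pure0r // -cv.
Qed.

(** On column s an element of the kernel has the form 1 (x) m, and the multiplication sends it to m;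
    hence m = 0. *)
Lemma relsyz_supported (B' : {aspace A}) s M : (B <= B')%VS -> column_supported s M ->
  (forall v, column v = s -> e v \in B') -> column_supported s.+1 (relsyz B' M).
Proof.
move=> sBB' supM eB' i lt_is k; apply: relsyz_val_inj; rewrite relsyz_valZ.
move: lt_is; rewrite ltnS leq_eqVlt => /orP[/eqP->|lt_is]; last first.
  exact: (tensor_supported sBB' supM lt_is).
have [m kE] := tensor_bottom sBB' supM eB' (relsyz_val k).
have ff : f s * f s = f s by rewrite columnM eqxx.
have kE' : f s *: relsyz_val k = pure B' 1 (f s *: m).
  rewrite -pure_bal ?(subvP sBB') ?column_in // mul1r.
  by rewrite -{1}ff -scalerA kE scale_pure mulr1.
have := mult_mapZ (f s) (relsyz_val k).
by rewrite relsyz_mult kE' scaler0 mult_map_pure scale1r => ->; rewrite pure0r.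
Qed.

(* Average corrects the B-linear map h on the bottom column V_s to the
   separable average \sum_v e_v h(e_v m), and transports the correction to
   column s + 1 along the partial inverse rho of the total arrow. *)
Section Average.

Variables (s : nat) (M N : lmodType A) (h : M -> N) (rho : M -> M).
Hypothesis supM : column_supported s M.
Hypothesis hB : sub_linear B h.
Hypothesis rhoD : {morph rho : x y / x + y}.
Hypothesis rhoK : forall k x, rho (k%:A *: x) = k%:A *: rho x.
Hypothesis rho_column : forall i x, rho (f i *: x) = if i == s.+1 then rho x else 0.
Hypothesis rho_total : forall x, a * f s = 0 \/ rho (a *: x) = f s *: x.

(** The correction is isolated as a difference because it alone, living in column s, is transported
    along [rho]; [h] is kept elsewhere. *)
Let E (m : M) : N := \sum_(v : V | column v == s) e v *: h (e v *: m) - f s *: h m.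

Definition average (m : M) : N := h m + E m + a *: E (rho m).

Let ED : {morph E : x y / x + y}.
Proof.
move=> x y; rewrite /E (proj1 hB) scalerDr opprD addrACA -big_split; congr (_ + _).
by apply: eq_bigr => v _; rewrite scalerDr (proj1 hB) scalerDr.
Qed.

Let EK k x : E (k%:A *: x) = k%:A *: E x.
Proof.
have hK y : h (k%:A *: y) = k%:A *: h y by rewrite (proj2 hB) ?scalar_in ?B1.
rewrite /E hK scalar_comm scalerBr scaler_sumr; congr (_ - _).
by apply: eq_bigr => v _; rewrite scalar_comm hK scalar_comm.
Qed.

Let E0 : E 0 = 0.
Proof. by apply: (addrI (E 0)); rewrite -ED !addr0. Qed.

Let fE i x : f i *: E x = if i == s then E x else 0.
Proof.
rewrite /E scalerBr scaler_sumr scalerA columnM.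
case: (eqVneq i s) => [->|ne].
  by congr (_ - _); apply: eq_bigr => v /eqP cv; rewrite -cv column_videmZ.
rewrite scale0r subr0 big1 // => v /eqP cv.
by rewrite scalerA column_videm cv eq_sym (negPf ne) scale0r.
Qed.

Let Ef i x : E (f i *: x) = if i == s then E x else 0.
Proof.
rewrite /E (proj2 hB) ?column_in // scalerA columnM eq_sym.
case: (eqVneq i s) => [->|ne].
  by congr (_ - _); apply: eq_bigr => v /eqP cv; rewrite -cv videm_columnZ.
rewrite scale0r subr0 big1 // => v /eqP cv.
by rewrite scalerA videm_column cv eq_sym (negPf ne) scale0r (sub_linear0 hB) scaler0.
Qed.

Let bottom_total (x : M) : f s *: (a *: x) = 0.
Proof.
rewrite scalerA; case: s supM => [|s'] sup; first by rewrite column0_total scale0r.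
by rewrite column_total -scalerA sup ?scaler0.
Qed.

Let Ea x : E (a *: x) = 0.
Proof. by have := Ef s (a *: x); rewrite eqxx bottom_total E0. Qed.

Let aErho x : a *: E (rho (a *: x)) = a *: E x.
Proof.
have -> : E (rho (a *: x)) = f s *: E (rho (a *: x)) by rewrite fE eqxx.
(* If a kills column s, as on the last column, both sides vanish and no partial inverse is required
   of [rho]. *)
rewrite scalerA; case: (rho_total x) => [as0|->]; last first.
  by rewrite Ef eqxx -scalerA fE eqxx.
have -> : E x = f s *: E x by rewrite fE eqxx.
by rewrite scalerA as0 !scale0r.
Qed.

Let scaler3 b (x y z : N) : b *: (x + y + z) = b *: x + b *: y + b *: z.
Proof. by rewrite !scalerDr. Qed.

Lemma average_sub_linear : sub_linear B average.
Proof.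
apply: gens_sub_linear => [x y|k x|i x|x].
- rewrite /average (proj1 hB) rhoD !ED scalerDr [RHS]addrACA.
  by congr (_ + _); rewrite addrACA.
- rewrite /average rhoK !EK (proj2 hB) ?scalar_in ?B1 //.
  by rewrite scalar_comm scaler3.
- rewrite /average scaler3 (proj2 hB) ?column_in // fE Ef rho_column.
  congr (_ + _); case: i => [|i].
    by rewrite E0 scaler0 scalerA column0_total scale0r.
  rewrite eqSS scalerA column_total -scalerA fE.
  by case: (i == s); rewrite ?E0.
- rewrite /average Ea addr0 aErho (proj2 hB) ?total_in // scaler3.
  by rewrite [a *: (a *: _)]scalerA total_arrow_sq scale0r addr0.
Qed.

Lemma average_videm v x : column v = s -> average (e v *: x) = e v *: average x.
Proof.
move=> cv; have evs (y : N) : e v *: (f s *: y) = e v *: y.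
  by rewrite scalerA videm_column cv eqxx.
have rho0 : rho (e v *: x) = 0.
  by rewrite -column_videmZ rho_column cv eqn_leq ltnn andbF.
have eE y : e v *: E y = e v *: h (e v *: y) - e v *: h y.
  rewrite /E scalerBr evs scaler_sumr (bigD1 v) ?cv ?eqxx //= scalerA videmM eqxx.
  rewrite big1 ?addr0 // => w /andP[_ wv].
  by rewrite scalerA videmM eq_sym (negPf wv) scale0r.
have Ee : E (e v *: x) = e v *: h (e v *: x) - h (e v *: x).
  rewrite /E -(proj2 hB) ?column_in // -{2}cv column_videmZ; congr (_ - _).
  rewrite (bigD1 v) ?cv ?eqxx //= scalerA videmM eqxx big1 ?addr0 // => w /andP[_ wv].
  by rewrite scalerA videmM (negPf wv) scale0r (sub_linear0 hB) scaler0.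
have eaE y : e v *: (a *: E y) = 0.
  have -> : E y = f s *: E y by rewrite fE eqxx.
  rewrite [a *: _]scalerA -column_total -scalerA [e v *: _]scalerA videm_column cv.
  by rewrite eqn_leq ltnn andbF scale0r.
by rewrite /average rho0 E0 scaler0 addr0 Ee scaler3 eaE eE addr0 addrCA subrr addr0 addrCA subrr addr0.
Qed.

(** The correction lies in the kernel of [p]: when [p \o h] already commutes with the e_v of column
    s, averaging it changes nothing, because these idempotents sum to f_s. *)
Lemma average_proj (P : lmodType A) (p : {linear N -> P}) :
    (forall v x, column v = s -> p (h (e v *: x)) = e v *: p (h x)) ->
  forall x, p (average x) = p (h x).
Proof.
move=> phe; have pE y : p (E y) = 0.
  rewrite /E linearB linear_sum linearZ /= /column_idem scaler_suml.
  apply/eqP; rewrite subr_eq0; apply/eqP; apply: eq_bigr => v /eqP cv.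
  by rewrite linearZ /= phe // scalerA videmM eqxx.
move=> x; rewrite /average (linearD p (h x + E x)) (linearD p (h x)) (linearZZ p).
by rewrite !pE scaler0 !addr0.
Qed.

End Average.

End ZigzagModules.

(** * The upper bound *)

Section UpperBound.

Variables (K : fieldType) (n : nat).

Local Notation A := (zigzag_alg K n).
Local Notation B := (zigzag_subalg K n).
Local Notation Q := (zigzag n).
Local Notation V := 'I_n.+2.
Local Notation e := (@videm K n.+1 Q).
Local Notation f := (column_idem K n).
Local Notation c := (n.+2)./2.
Local Notation a := (total_arrow K n).
Local Notation B1 := (zigzag_subalg1 K n).

Implicit Types M N : lmodType A.

Lemma scalarD k l M (m : M) : (k + l)%:A *: m = k%:A *: m + l%:A *: m.
Proof. by rewrite !scalerDl. Qed.

Lemma scalarM k l M (m : M) : (k * l)%:A *: m = k%:A *: (l%:A *: m).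
Proof. by rewrite scalerA -scalerAl mul1r scalerA. Qed.

(** * Coordinates in the path basis *)

Definition pcoef (p : V + arrow Q) (g : A) : K := (g : radsq K Q) p.

Lemma pcoefD p g h : pcoef p (g + h) = pcoef p g + pcoef p h.
Proof. by rewrite /pcoef ffunE. Qed.

Lemma pcoefZ p k g : pcoef p (k *: g) = k * pcoef p g.
Proof. by rewrite /pcoef ffunE. Qed.

Lemma pcoef_vertexM v g h : pcoef (inl v) (g * h) = pcoef (inl v) g * pcoef (inl v) h.
Proof. by rewrite /pcoef ffunE. Qed.

Lemma pcoef_arrowM x g h : pcoef (inr x) (g * h) =
  pcoef (inl (tgt x)) g * pcoef (inr x) h + pcoef (inr x) g * pcoef (inl (src x)) h.
Proof. by rewrite /pcoef ffunE. Qed.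

Lemma pcoef_vertex1 v : pcoef (inl v) 1 = 1.
Proof. by rewrite /pcoef ffunE. Qed.

Lemma pcoef_arrow1 x : pcoef (inr x) 1 = 0.
Proof. by rewrite /pcoef ffunE. Qed.

Lemma pcoef_sum p (I : finType) (P : pred I) (F : I -> A) :
  pcoef p (\sum_(i | P i) F i) = \sum_(i | P i) pcoef p (F i).
Proof.
apply: (big_morph (pcoef p)) => [g h|]; first exact: pcoefD.
by rewrite /pcoef ffunE.
Qed.

Lemma pcoef_videm p v : pcoef p (e v) = (p == inl v)%:R.
Proof. by rewrite /pcoef ffunE. Qed.

Lemma pcoef_varrow p x : pcoef p (varrow K x) = (p == inr x)%:R.
Proof. by rewrite /pcoef ffunE. Qed.

Lemma pcoef_vertex_column v i : pcoef (inl v) (f i) = (column v == i)%:R.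
Proof.
rewrite pcoef_sum big_mkcond (bigD1 v) //= pcoef_videm eqxx big1 ?addr0 => [|u uv].
  by case: ifP.
by case: ifP => // _; rewrite pcoef_videm (inj_eq inl_inj) eq_sym (negPf uv).
Qed.

Lemma pcoef_arrow_column x i : pcoef (inr x) (f i) = 0.
Proof. by rewrite pcoef_sum big1 // => v _; rewrite pcoef_videm. Qed.

Lemma pcoef_vertex_total v : pcoef (inl v) a = 0.
Proof. by rewrite pcoef_sum big1 // => x _; rewrite pcoef_varrow. Qed.

Lemma pcoef_arrow_total x : pcoef (inr x) a = 1.
Proof.
have E y : pcoef (inr x) (varrow K y) = if y == x then 1 else 0.
  by rewrite pcoef_varrow (inj_eq inr_inj) eq_sym; case: (y == x).
by rewrite pcoef_sum (eq_bigr _ (fun y _ => E y)) -big_mkcond big_pred1_eq.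
Qed.

Lemma supported_total s M : column_supported s M -> forall m : M, f s *: (a *: m) = 0.
Proof.
move=> supM m; rewrite scalerA; case: s supM => [|s] supM.
  by rewrite column0_total scale0r.
by rewrite column_total -scalerA supM ?scaler0.
Qed.

Lemma column_pairP s (v0 v1 v : V) : label v0 = s.*2 -> label v1 = s.*2.+1 ->
  column v = s -> v = v0 \/ v = v1.
Proof.
move=> l0 l1; rewrite /column => cv.
have : (label v == s.*2) || (label v == s.*2.+1) by lia.
by case/orP=> /eqP lv; [left|right]; apply: label_inj; rewrite lv.
Qed.

Lemma column_pair s (v0 v1 : V) : label v0 = s.*2 -> label v1 = s.*2.+1 ->
  f s = e v0 + e v1.
Proof.
move=> l0 l1; have c0 : column v0 = s by rewrite /column l0 doubleK.
have c1 : column v1 = s by rewrite /column l1 /= uphalf_double.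
have v01 : (v0 == v1) = false by apply/eqP => E; move: l1; rewrite -E l0; lia.
rewrite /column_idem (bigD1 v0) ?c0 ?eqxx // (bigD1 v1); last first.
  by rewrite c1 eqxx eq_sym v01.
rewrite big1 => [|v /andP[/andP[/eqP cv]]]; first by rewrite /= addr0.
by case: (column_pairP l0 l1 cv) => ->; rewrite ?eqxx ?andbF.
Qed.

(** * The partial inverse of the total arrow on the first syzygy *)

Section Syzygy.

Variables (s : nat) (M : lmodType A) (v0 v1 : V) (x y : arrow Q).
Hypothesis supM : column_supported s M.
Hypotheses (l0 : label v0 = s.*2) (l1 : label v1 = s.*2.+1).
Hypotheses (sx : src x = v0) (sy : src y = v1) (txy : tgt x = tgt y).

Let c0 : column v0 = s. Proof. by rewrite /column l0 doubleK. Qed.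
Let c1 : column v1 = s. Proof. by rewrite /column l1 /= uphalf_double. Qed.

Let v01 : (v0 == v1) = false.
Proof. by apply/eqP => E; move: l1; rewrite -E l0; lia. Qed.

Let column_s v : column v = s -> v = v0 \/ v = v1.
Proof. exact: (column_pairP l0 l1). Qed.

Let column_sE : f s = e v0 + e v1. Proof. exact: column_pair. Qed.

(** The generators of B separate neither the two vertices of column s nor the two arrows, and
    products inherit this because [x] and [y] share a target. In the last clause a contributes
    nothing, since M begins in column s. *)
Lemma pcoef_subalg b : b \in B -> [/\ pcoef (inl v0) b = pcoef (inl v1) b,
  pcoef (inr x) b = pcoef (inr y) b
  & forall m : M, f s *: (b *: m) = (pcoef (inl v0) b)%:A *: (f s *: m)].
Proof.
move: b; apply: agenv_span_ind.
- by rewrite !pcoef_vertex1 !pcoef_arrow1; split=> // m; rewrite !scale1r.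
- move=> k b b' [P1 P2 P3] [P1' P2' P3']; rewrite !pcoefD !pcoefZ P1 P2 P1' P2'.
  split=> // m; rewrite scalerDl (scalarE k b m) scalerDr scalar_comm P3 P3'.
  by rewrite P1 P1' scalarD scalarM.
- move=> b b' [P1 P2 P3] [P1' P2' P3'].
  rewrite !pcoef_vertexM !pcoef_arrowM P1 P2 P1' P2' txy sx sy P1'; split=> // m.
  by rewrite -scalerA P3 P3' P1 P1' scalarM.
- move=> u; rewrite mem_cat => /orP[] /mapP[i _ ->].
    rewrite !pcoef_vertex_column !pcoef_arrow_column c0 c1; split=> // m.
    by rewrite scalerA columnM; case: eqP => [->|_]; rewrite ?scale1r ?scale0r ?scaler0.
  rewrite column_arrowsE !pcoef_vertexM !pcoef_arrowM !pcoef_vertex_total !pcoef_arrow_total.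
  rewrite !pcoef_vertex_column !pcoef_arrow_column sx sy c0 c1 !mul0r; split=> // m.
  by rewrite -scalerA supported_total // !scale0r.
Qed.

Let branch_form (g : A) (m : M) : M := (pcoef (inr x) g - pcoef (inr y) g)%:A *: (f s *: m).

Let branch_formDl m : {morph branch_form^~ m : g h / g + h}.
Proof. by move=> g h; rewrite /branch_form !pcoefD opprD addrACA scalarD. Qed.

Let branch_formDr g : {morph branch_form g : m m' / m + m'}.
Proof. by move=> m m'; rewrite /branch_form !scalerDr. Qed.

Let branch_form_bal g b m : b \in B -> branch_form (g * b) m = branch_form g (b *: m).
Proof.
move=> /pcoef_subalg[P1 P2 P3]; rewrite /branch_form P3 !pcoef_arrowM sx sy txy P2 -P1.
(* The terms in which [b] supplies the arrow cancel: their factors from [g] are both the coefficient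
   at the common target. *)
rewrite opprD addrACA subrr add0r -mulrBl mulrC scalarM.
exact: scalar_comm.
Qed.

(* On column s the relative syzygy of M consists of the e_v0 (x) p + e_v1 (x) q
   with p in e_v1 M and q in e_v0 M; the total arrow sends this element into
   column s + 1, where branch recovers p - q. *)
Definition branch (t : tensor B M) : M := tensor_lift branch_form t.

Lemma branch_pure g m :
  branch (pure B g m) = (pcoef (inr x) g - pcoef (inr y) g)%:A *: (f s *: m).
Proof. exact: (tensor_lift_pure branch_formDl branch_formDr branch_form_bal). Qed.

Lemma branchD : {morph branch : t u / t + u}.
Proof. exact: (tensor_liftD branch_formDl branch_formDr branch_form_bal). Qed.

Lemma branchK k t : branch (k%:A *: t) = k%:A *: branch t.
Proof.
have b0 : branch 0 = 0 by apply: (addrI (branch 0)); rewrite -branchD !addr0.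
elim/tensor_elim: t => [|t u IHt IHu|g m]; first by rewrite scaler0 b0 scaler0.
  by rewrite scalerDr !branchD IHt IHu scalerDr.
by rewrite scale_pure !branch_pure -scalerAl mul1r !pcoefZ -mulrBr scalarM.
Qed.

Lemma bottom_tensor (t : tensor B M) : exists p q : M,
  [/\ f s *: p = p, f s *: q = q & f s *: t = pure B (e v0) p + pure B (e v1) q].
Proof.
elim/(@tensor_path_ind K n): t => [||t u [p [q [pE qE tE]]] [p' [q' [pE' qE' uE]]]|v m mE|z m mE].
- exact: subvv.
- by exists 0, 0; rewrite !scaler0 !pure0r addr0.
- exists (p + p'), (q + q'); rewrite !scalerDr pE qE pE' qE' tE uE; split=> //.
  by rewrite !pureDr addrACA.
- rewrite scale_pure column_videm; case: eqP => [cv|_]; last first.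
    by exists 0, 0; rewrite !scaler0 !pure0r addr0 pure0l.
  rewrite cv in mE; case: (column_s cv) => ->.
    by exists m, 0; rewrite mE scaler0 pure0r addr0.
  by exists 0, m; rewrite mE scaler0 pure0r add0r.
- exists 0, 0; split; [exact: scaler0 | exact: scaler0 |].
  have -> : pure B (e v0) (0 : M) + pure B (e v1) 0 = 0 by rewrite !pure0r addr0.
  rewrite scale_pure column_arrow column_tgt; case: eqP => [cv|_]; last exact: pure0l.
  have m0 : m = 0 by rewrite -mE supM // -cv.
  by rewrite m0 pure0r.
Qed.

Let syz : lmodType A := relsyz B M.

(** For [t] = a k, with k = e_v0 (x) p + e_v1 (x) q in the syzygy, [branch] returns p - q. Its e_v1
    part is p and its e_v0 part is -q, whence the crossed idempotents and the minus sign. Cutting by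
    f_(s+1) first makes the map vanish on the other columns. *)
Definition retract_tensor (t : tensor B M) : tensor B M :=
  let p := branch (f s.+1 *: t) in
  pure B (e v0) (e v1 *: p) - pure B (e v1) (e v0 *: p).

Lemma retract_tensor_mult t : mult_map (retract_tensor t) = 0.
Proof.
rewrite /retract_tensor -pureNl mult_mapD !mult_map_pure scaleNr !scalerA !videmM.
by rewrite v01 [v1 == v0]eq_sym v01 !scale0r subr0.
Qed.

Definition retract (k : syz) : syz :=
  projT1 (cid (relsyz_intro (retract_tensor_mult (relsyz_val k)))).

Lemma retractE k : relsyz_val (retract k) = retract_tensor (relsyz_val k).
Proof. by rewrite /retract; case: cid. Qed.

Lemma retractD : {morph retract : k l / k + l}.
Proof.
move=> k l; apply: relsyz_val_inj; rewrite relsyz_valD !retractE /retract_tensor.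
by rewrite relsyz_valD scalerDr branchD !scalerDr !pureDr opprD addrACA.
Qed.

Lemma retractK b k : retract (b%:A *: k) = b%:A *: retract k.
Proof.
apply: relsyz_val_inj; rewrite relsyz_valZ !retractE /retract_tensor relsyz_valZ.
rewrite scalar_comm branchK !(scalar_comm b) scalerBr !scale_pure.
by rewrite -!scalerAl !mul1r !pure_scalar ?B1.
Qed.

Lemma retract_column i k : retract (f i *: k) = if i == s.+1 then retract k else 0.
Proof.
apply: relsyz_val_inj; rewrite retractE /retract_tensor relsyz_valZ scalerA columnM eq_sym.
case: eqP => _; first by rewrite retractE.
have b0 : branch 0 = 0 by apply: (addrI (branch 0)); rewrite -branchD !addr0.
by rewrite scale0r b0 !scaler0 !pure0r subr0.
Qed.

Lemma retract_total k : retract (a *: k) = f s *: k.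
Proof.
apply: relsyz_val_inj; rewrite retractE /retract_tensor !relsyz_valZ.
have [p [q [pE qE kE]]] := bottom_tensor (relsyz_val k).
rewrite scalerA column_total -scalerA kE scalerDr !scale_pure branchD !branch_pure.
rewrite pE qE !pcoef_arrowM !pcoef_arrow_total !pcoef_vertex_total sx sy !pcoef_videm.
rewrite !(inj_eq inl_inj) !eqxx v01 [v1 == v0]eq_sym v01 !mul1r !mul0r !add0r.
rewrite /= !mulr1n !mulr0n subr0 !scaleNr !scale1r.
(* Vanishing of the product, e_v0 p + e_v1 q = 0, is what places p at v1 and q at v0. *)
have /(congr1 (fun t => mult_map t)) := kE.
rewrite mult_mapZ relsyz_mult scaler0 mult_mapD !mult_map_pure => pq.
have p0 : e v0 *: p = 0.
  have /(congr1 (fun m => e v0 *: m)) := pq.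
  by rewrite scalerDr !scalerA !videmM eqxx v01 scaler0 scale0r addr0.
have q0 : e v1 *: q = 0 by rewrite p0 add0r in pq.
have p1 : e v1 *: p = p by rewrite -[RHS]pE column_sE scalerDl p0 add0r.
have q1 : e v0 *: q = q by rewrite -[RHS]qE column_sE scalerDl q0 addr0.
by rewrite !scalerBr p1 q0 p0 q1 subr0 sub0r pureNr opprK.
Qed.

End Syzygy.
(** Commutation with e_v is settled by column: below s the module vanishes, on s the average
    provides it, and on s + 1, beyond which no column exists, e_v is the column idempotent and lies
    in B. *)
Lemma average_projective s M (rho : M -> M) :
    column_supported s M -> {morph rho : x y / x + y} ->
    (forall k x, rho (k%:A *: x) = k%:A *: rho x) ->
    (forall i x, rho (f i *: x) = if i == s.+1 then rho x else 0) ->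
    (forall x, a * f s = 0 \/ rho (a *: x) = f s *: x) ->
    (c <= s.+1)%N -> (forall v, column v = s.+1 -> e v = f s.+1) ->
  rel_projective B M.
Proof.
move=> supM rhoD rhoK rhof rhoa le_cs single.
have hB := pure1_sub_linear B M.
pose tau := average s (pure B (1 : A) : M -> tensor B M) rho.
have tauB : sub_linear B tau by apply: average_sub_linear.
have tau_e v x : tau (e v *: x) = e v *: tau x.
  case: (ltngtP (column v) s) => [lt_vs|lt_sv|cv]; last exact: average_videm.
    rewrite -[e v *: x]videm_columnZ supM // scaler0 (sub_linear0 tauB).
    rewrite -videm_columnZ -(proj2 tauB) ?column_in // supM //.
    by rewrite (sub_linear0 tauB) scaler0.
  have cv : column v = s.+1 by have := column_le v; lia.
  by rewrite single // (proj2 tauB) ?column_in.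
pose l := GRing.isLinear.Build _ _ _ _ _ (vertex_linear tauB tau_e).
exists (HB.pack tau l : {linear M -> tensor B M}) => x.
have := @average_proj K n s M _ (pure B (1 : A)) rho M (mult_map (B := B) (M := M)).
move=> tauE; apply: etrans (tauE _ x) _ => [v y _|] /=; rewrite !mult_map_pure !scale1r //.
Qed.

Lemma last_column_projective M : column_supported c M -> rel_projective B M.
Proof.
move=> supM; apply: (average_projective (rho := fun=> 0)) supM _ _ _ _ _ _ => //.
- by move=> x y; rewrite addr0.
- by move=> k x; rewrite scaler0.
- by move=> i x; case: ifP.
- by left; rewrite -column_total column_out // mul0r.
- by move=> v cv; have := column_le v; rewrite cv ltnn.
Qed.

(** The map m to 1 (x) (1 (x) m) is B-linear, and averaging makes it B'-linear. It still lifts 1 (x)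
    m, which depends B'-linearly on m, so [average_proj] applies. *)
Lemma split_tensor_projective s M (rho : M -> M) :
    column_supported s M -> {morph rho : x y / x + y} ->
    (forall k x, rho (k%:A *: x) = k%:A *: rho x) ->
    (forall i x, rho (f i *: x) = if i == s.+1 then rho x else 0) ->
    (forall x, a * f s = 0 \/ rho (a *: x) = f s *: x) ->
  rel_projective B (tensor (column_split K n s) M).
Proof.
set B' := column_split K n s => supM rhoD rhoK rhof rhoa.
have sBB' : (B <= B')%VS := sub_column_split K n s.
pose h (m : M) : tensor B (tensor B' M) := pure B 1 (pure B' 1 m).
have hB : sub_linear B h.
  have [D1 Z1] := pure1_sub_linear B' M.
  have [D2 Z2] := pure1_sub_linear B (tensor B' M).
  by split=> [x y|b x Bb]; rewrite /h ?D1 ?D2 // Z1 ?Z2 // (subvP sBB').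
pose tau := average s h rho.
have tauB : sub_linear B tau by apply: average_sub_linear.
apply: (tensor_rel_projective (h := tau)).
  apply: split_sub_linear; first exact: (proj1 tauB).
  - by move=> k x; rewrite (proj2 tauB) ?scalar_in ?B1.
  - by move=> i x; rewrite (proj2 tauB) ?column_in.
  - by move=> x; rewrite (proj2 tauB) ?total_in.
  - by move=> v x /eqP cv; apply: average_videm.
move=> x; rewrite /tau (average_proj rho (p := mult_map (B := B) (M := tensor B' M))).
  by rewrite /h /= mult_map_pure scale1r.
move=> v y cv; rewrite /h /= !mult_map_pure !scale1r.
by rewrite (proj2 (pure1_sub_linear B' M)) // /B' -cv videm_in_split.
Qed.

(** The number n + 1 - 2s counts the vertices 2s + 2, ..., n + 2 beyond column s. *)
Lemma rel_dim_supported s M : (0 < s)%N -> (s <= c)%N -> fin_gen M ->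
  column_supported s M -> rel_dim_le B (n.+1 - s.*2) M.
Proof.
move=> s_gt0 le_sc; move Ed: (c - s)%N => d.
elim: d s s_gt0 le_sc Ed M => [|d IHd] s s_gt0 le_sc Ed M fgM supM.
  have sc : s = c by lia.
  (* For even n the last column is the single vertex n + 2 = 2s, and the subtraction is
     truncated. *)
  have -> : (n.+1 - s.*2 = 0)%N by lia.
  by split=> //; apply: last_column_projective; rewrite -sc.
have [v0 l0] : exists v : V, label v = s.*2 by apply: vertex_of_label; lia.
have [v1 l1] : exists v : V, label v = s.*2.+1 by apply: vertex_of_label; lia.
have [w lw] : exists v : V, label v = s.*2.+2 by apply: vertex_of_label; lia.
have [x [sx tx]] : exists x : arrow Q, src x = v0 /\ tgt x = w.
  by apply: edge_arrow; rewrite l0 lw /zigzag_edge; lia.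
have [y [sy ty]] : exists x : arrow Q, src x = v1 /\ tgt x = w.
  by apply: edge_arrow; rewrite l1 lw /zigzag_edge; lia.
have txy : tgt x = tgt y by rewrite tx ty.
have rD := retractD supM l0 l1 sx sy txy.
have rK := retractK supM l0 l1 sx sy txy.
have rf := retract_column supM l0 l1 sx sy txy.
have ra := retract_total supM l0 l1 sx sy txy.
have subBB : (B <= B)%VS := subvv _.
have supK : column_supported s (relsyz B M).
  by move=> i lt_is k; apply: relsyz_val_inj; rewrite relsyz_valZ (tensor_supported subBB supM).
have fgK := relsyz_fin_gen B1 subBB fgM.
(* For even n the last column has one vertex, so one column before it the first syzygy is already
   projective. *)
case: (boolP ((s.+1 == c) && ~~ odd n)) => [/andP[/eqP sc n_even]|full].
  have -> : (n.+1 - s.*2 = 1)%N by lia.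
  apply: (relsyz_rel_dim B1 subBB) => //; first exact: tensor_projective.
  split=> //; apply: (average_projective supK rD rK rf) => [k||v cv].
  - by right; apply: ra.
  - by rewrite sc.
  - rewrite /column_idem (big_pred1 v) // => u; apply/eqP/eqP => [cu|->//].
    by apply: label_inj; move: cu cv (ltn_ord u) (ltn_ord v); rewrite /column /label; lia.
have -> : (n.+1 - s.*2 = (n.+1 - s.+1.*2).+2)%N by lia.
apply: (relsyz_rel_dim B1 subBB) => //; first exact: tensor_projective.
have sBB' := sub_column_split K n s.
apply: (relsyz_rel_dim B1 sBB') => //.
  by apply: (split_tensor_projective supK rD rK rf) => k; right; apply: ra.
apply: IHd; [by [] | lia | lia | exact: (relsyz_fin_gen B1 sBB' fgK) | ].
by apply: relsyz_supported => // v <-; apply: videm_in_split.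
Qed.

Lemma column0 v : column v = 0%N -> e v = f 0%N.
Proof.
move=> cv; rewrite /column_idem (big_pred1 v) // => u; apply/eqP/eqP => [cu|->//].
by apply: label_inj; move: cu cv; rewrite /column /label; lia.
Qed.

Lemma zigzag_rel_dim M : (0 < n)%N -> fin_gen M -> rel_dim_le B n M.
Proof.
move=> n_gt0 fgM; have En : (n.+1 - 1.*2).+1 = n by lia.
rewrite -[X in rel_dim_le _ X]En.
have subBB : (B <= B)%VS := subvv _.
apply: (relsyz_rel_dim B1 subBB) => //; first exact: tensor_projective.
apply: (rel_dim_supported (s := 1)) => //.
  exact: (relsyz_fin_gen B1 subBB fgM).
by apply: relsyz_supported => // v cv; rewrite column0 // column_in.
Qed.

End UpperBound.

(** * Thin modules *)

(** The representation with identity maps satisfies the relations of A exactly when no path of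
    length two stays in the support; [act_mul] uses this to obtain associativity. *)
Definition path_free (n : nat) (T : pred nat) : Prop :=
  forall x y : arrow (zigzag n), tgt x = src y -> T (label (src x)) ->
    T (label (tgt x)) -> T (label (tgt y)) -> False.

(* The representation with a copy of K at every vertex whose label lies in T,
   and the identity along every arrow between such vertices. *)
Definition thin (K : fieldType) (n : nat) (T : pred nat) (T_free : path_free n T) : Type :=
  {ffun {v : 'I_n.+2 | T (label v)} -> K}.

HB.instance Definition _ K n T T_free :=
  GRing.Zmodule.copy (@thin K n T T_free) {ffun {v : 'I_n.+2 | T (label v)} -> K}.

Section ThinModule.

Variables (K : fieldType) (n : nat) (T : pred nat) (T_free : path_free n T).

Local Notation A := (zigzag_alg K n).
Local Notation B := (zigzag_subalg K n).
Local Notation Q := (zigzag n).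
Local Notation V := 'I_n.+2.
Local Notation e := (@videm K n.+1 Q).
Local Notation f := (column_idem K n).
Local Notation a := (total_arrow K n).
Local Notation X := (@thin K n T T_free).

Implicit Types (u : X) (g : A).

Definition value u (l : nat) : K :=
  \sum_(w : {v : V | T (label v)} | label (val w) == l) (u : {ffun _ -> K}) w.

Definition thin_of (F : V -> K) : X := [ffun w => F (val w)].

Lemma value_ffun u w : value u (label (val w)) = (u : {ffun _ -> K}) w.
Proof.
by rewrite /value (big_pred1 w) // => w'; rewrite (inj_eq (@label_inj n)) (inj_eq val_inj).
Qed.

Lemma value_of F v : T (label v) -> value (thin_of F) (label v) = F v.
Proof.
by move=> Tv; rewrite -[v](SubK {v | T (label v)} Tv) value_ffun ffunE.
Qed.

Lemma value_out u l : ~~ T l -> value u l = 0.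
Proof.
move=> Tl; rewrite /value big_pred0 // => w; apply: contraNF Tl => /eqP <-.
exact: (valP w).
Qed.

Lemma value_range u l : ~~ (0 < l <= n.+2)%N -> value u l = 0.
Proof.
move=> rl; rewrite /value big_pred0 // => w; apply: contraNF rl => /eqP <-.
by rewrite /label /=; have := ltn_ord (val w).
Qed.

Lemma value0 u : value u 0 = 0.
Proof. exact: value_range. Qed.

Lemma value_inj u u' : (forall v : V, T (label v) -> value u (label v) = value u' (label v)) ->
  u = u'.
Proof. by move=> uu'; apply/ffunP=> w; rewrite -!value_ffun uu' ?(valP w). Qed.

Lemma valueD u u' l : value (u + u') l = value u l + value u' l.
Proof. by rewrite /value -big_split; apply: eq_bigr => w _; rewrite ffunE. Qed.

Lemma value_zero l : value 0 l = 0.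
Proof. by rewrite /value big1 // => w _; rewrite ffunE. Qed.

Lemma value_sum (I : finType) (P : pred I) (F : I -> X) l :
  value (\sum_(i | P i) F i) l = \sum_(i | P i) value (F i) l.
Proof.
exact: (big_morph (value^~ l) (fun u u' => valueD u u' l) (value_zero l)).
Qed.

Definition act g u : X := thin_of (fun v => pcoef (inl v) g * value u (label v) +
  \sum_(x : arrow Q | tgt x == v) pcoef (inr x) g * value u (label (src x))).

Lemma value_act g u v : T (label v) -> value (act g u) (label v) =
  pcoef (inl v) g * value u (label v) +
  \sum_(x : arrow Q | tgt x == v) pcoef (inr x) g * value u (label (src x)).
Proof. exact: value_of. Qed.

Fact act_mul g h u : act g (act h u) = act (g * h) u.
Proof.
apply: value_inj => v Tv; rewrite !value_act // pcoef_vertexM mulrDr mulrA -addrA.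
congr (_ + _); rewrite mulr_sumr -big_split; apply: eq_bigr => x /eqP xv /=.
rewrite pcoef_arrowM mulrDl xv mulrA; congr (_ + _); rewrite -mulrA; congr (_ * _).
case: (boolP (T (label (src x)))) => [Tx|Tx]; last by rewrite !value_out ?mulr0.
rewrite value_act // big1 ?addr0 // => y /eqP yx.
case: (boolP (T (label (src y)))) => [Ty|Ty]; last by rewrite value_out ?mulr0.
by case: (T_free yx Ty); rewrite ?yx ?xv.
Qed.

Fact act_1 : left_id 1 act.
Proof.
move=> u; apply: value_inj => v Tv; rewrite value_act // pcoef_vertex1 mul1r.
by rewrite big1 ?addr0 // => x _; rewrite pcoef_arrow1 mul0r.
Qed.

Fact act_Dr : right_distributive act +%R.
Proof.
move=> g u u'; apply: value_inj => v Tv; rewrite valueD !value_act // valueD mulrDr.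
rewrite addrACA -big_split; congr (_ + _); apply: eq_bigr => x _.
by rewrite valueD mulrDr.
Qed.

Fact act_Dl u : {morph act^~ u : g h / g + h}.
Proof.
move=> g h; apply: value_inj => v Tv; rewrite valueD !value_act // pcoefD mulrDl.
rewrite addrACA -big_split; congr (_ + _); apply: eq_bigr => x _.
by rewrite pcoefD mulrDl.
Qed.

HB.instance Definition _ :=
  GRing.Zmodule_isLmodule.Build A X act_mul act_1 act_Dr act_Dl.

Lemma value_scale g u v : T (label v) -> value (g *: u) (label v) =
  pcoef (inl v) g * value u (label v) +
  \sum_(x : arrow Q | tgt x == v) pcoef (inr x) g * value u (label (src x)).
Proof. exact: value_of. Qed.

Lemma value_ext u (F : nat -> K) :
    (forall v : V, T (label v) -> value u (label v) = F (label v)) ->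
    (forall l, ~~ ((0 < l <= n.+2)%N && T l) -> F l = 0) ->
  forall l, value u l = F l.
Proof.
move=> uF F0 l; case: (boolP ((0 < l <= n.+2)%N && T l)) => [/andP[/andP[l1 l2]]|Tl].
  by have [v <-] := vertex_of_label l1 l2; apply: uF.
by rewrite F0 //; move: Tl; rewrite negb_and => /orP[/value_range|/value_out].
Qed.

Lemma value_junk u l : ~~ ((0 < l <= n.+2)%N && T l) -> value u l = 0.
Proof. by rewrite negb_and => /orP[/value_range|/value_out]. Qed.

Lemma value_scalar k u l : value (k%:A *: u) l = k * value u l.
Proof.
move: l; apply: value_ext => [v Tv|l Tl]; last by rewrite value_junk ?mulr0.
rewrite value_scale // pcoefZ pcoef_vertex1 mulr1 big1 ?addr0 // => x _.
by rewrite pcoefZ pcoef_arrow1 mulr0 mul0r.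
Qed.

Lemma value_videm w u l : value (e w *: u) l = if l == label w then value u l else 0.
Proof.
move: l; apply: value_ext => [v Tv|l Tl]; last by rewrite value_junk ?if_same.
rewrite value_scale // pcoef_videm (inj_eq inl_inj) (inj_eq (@label_inj n)) big1.
  by rewrite addr0; case: eqP; rewrite ?mul1r ?mul0r.
by move=> x _; rewrite pcoef_videm mul0r.
Qed.

Lemma value_column i u l : value (f i *: u) l = if l./2 == i then value u l else 0.
Proof.
move: l; apply: value_ext => [v Tv|l Tl]; last by rewrite value_junk ?if_same.
rewrite value_scale // pcoef_vertex_column big1 ?addr0.
  by rewrite /column; case: eqP; rewrite ?mul1r ?mul0r.
by move=> x _; rewrite pcoef_arrow_column mul0r.
Qed.

(** The sum of [G] over the predecessors of a vertex: 2k + 2 receives from 2k and 2k + 1, 2k + 3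
    from 2k, and 3 from 1. At the vertex 2 the summand [G 0] is a dummy, whence the recurrent
    condition [G 0 = 0]. *)
Definition inflow (G : nat -> K) (l : nat) : K :=
  if (l <= 1)%N then 0
  else if odd l then G (if l == 3%N then 1%N else l - 3)%N else G (l - 2)%N + G (l - 1)%N.

Lemma sum_vertex (G : nat -> K) l : G 0%N = 0 -> (l <= n.+2)%N ->
  \sum_(v : V) (if label v == l then G (label v) else 0) = G l.
Proof.
case: l => [|l] G0 l_le; first by rewrite G0 big1.
have [w lw] := vertex_of_label (ltn0Sn l) l_le.
rewrite -big_mkcond (big_pred1 w) ?lw // => v.
by rewrite -lw (inj_eq (@label_inj n)).
Qed.

Lemma sum_inflow (G : nat -> K) v : G 0%N = 0 ->
  \sum_(x : arrow Q | tgt x == v) G (label (src x)) = inflow G (label v).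
Proof.
move=> G0; have lv : (0 < label v <= n.+2)%N by rewrite /label /=; have := ltn_ord v.
rewrite (partition_big (@src _ Q) predT) //.
rewrite (eq_bigr (fun u : V => if zigzag_edge (label u) (label v) then G (label u) else 0)); last first.
  move=> w _; case: (boolP (zigzag_edge _ _)) => [uv|nuv].
    have [x [xu xv]] := edge_arrow uv.
    rewrite (big_pred1 x) ?xu // => y; apply/andP/eqP => [[/eqP yv /eqP yu]|->].
      by apply: arrow_inj; rewrite ?xu ?xv.
    by rewrite xu xv !eqxx.
  rewrite big_pred0 // => x; apply: contraNF nuv => /andP[/eqP <- /eqP <-].
  exact: arrow_edge.
rewrite /inflow; case: ifP => l1.
  by rewrite big1 // => u _; case: ifP => //; rewrite /zigzag_edge; lia.
case: ifP => lodd.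
  set l' := (if _ then _ else _)%N.
  have l'_le : (l' <= n.+2)%N by rewrite /l'; case: eqP; lia.
  have l'E i : (0 < i)%N -> zigzag_edge i (label v) = (i == l').
    by rewrite /l' /zigzag_edge; case: (label v =P 3%N) => l3; lia.
  by rewrite -(sum_vertex G0 l'_le); apply: eq_bigr => w _; rewrite l'E.
have l1_le : (label v - 1 <= n.+2)%N by lia.
have l2_le : (label v - 2 <= n.+2)%N by lia.
rewrite -(sum_vertex G0 l1_le) -(sum_vertex G0 l2_le).
rewrite -big_split; apply: eq_bigr => u _ /=; rewrite /zigzag_edge.
have lu : (0 < label u)%N by [].
case: (eqVneq (label u) (label v - 2)%N) => E1; case: (eqVneq (label u) (label v - 1)%N) => E2.
- by lia.
- by rewrite addr0 (_ : _ && _ = true) //; lia.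
- by rewrite add0r (_ : _ && _ = true) //; lia.
- by rewrite addr0 (_ : _ && _ = false) //; lia.
Qed.

Lemma value_total u l : value (a *: u) l =
  if (0 < l <= n.+2)%N && T l then inflow (value u) l else 0.
Proof.
move: l; apply: value_ext => [v Tv|l Tl]; last by rewrite (negPf Tl).
rewrite Tv value_scale // pcoef_vertex_total mul0r add0r.
have -> : (0 < label v <= n.+2)%N by rewrite /label /=; have := ltn_ord v.
rewrite -sum_inflow ?value0 //; apply: eq_bigr => x _.
by rewrite pcoef_arrow_total mul1r.
Qed.

Lemma thin_fin_gen : fin_gen X.
Proof.
pose d (v : V) : X := thin_of (fun w => (w == v)%:R).
apply: (fin_gen_intro (s := d)) => u; exists (fun v => (value u (label v))%:A).
apply: value_inj => v Tv.
rewrite value_sum (bigD1 v) //= value_scalar value_of // eqxx mulr1 big1 ?addr0 // => w wv.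
by rewrite value_scalar value_of // eq_sym (negPf wv) mulr0.
Qed.

Definition basis (v : V) : X := thin_of (fun w => (w == v)%:R).

Lemma value_basis v l : value (basis v) l = (T l && (l == label v))%:R.
Proof.
move: l; apply: value_ext => [w Tw|l Tl].
  by rewrite value_of // Tw (inj_eq (@label_inj n)).
case: eqP => [lv|_]; last by rewrite andbF.
rewrite andbT; move: Tl; rewrite lv negb_and; case: (T _); rewrite ?orbF //.
by rewrite /label /=; have := ltn_ord v; lia.
Qed.

Lemma basis_sum u : u = \sum_(v : V) (value u (label v))%:A *: basis v.
Proof.
apply: value_inj => v Tv; rewrite value_sum (bigD1 v) //= value_scalar value_basis.
rewrite Tv eqxx mulr1 big1 ?addr0 // => w wv.
by rewrite value_scalar value_basis (inj_eq (@label_inj n)) eq_sym (negPf wv) andbF mulr0.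
Qed.

Section Cyclic.

Variables (omega : X) (g : V -> A).
Hypothesis videm_g : forall w v, e w * g v = if w == v then g v else 0.
Hypothesis g_omega : forall v, T (label v) -> g v *: omega = basis v.
Hypothesis total_g : forall v, T (label v) -> pure B (a * g v) omega =
  \sum_(x : arrow Q | (src x == v) && T (label (tgt x))) pure B (g (tgt x)) omega.

Let section u : tensor B X := \sum_(v : V) (value u (label v))%:A *: pure B (g v) omega.

(** The section sends the basis vector at v to g_v (x) omega. The hypothesis [total_g] asks that a
    act on these tensors, before multiplication, as it acts on the basis vectors. *)
Lemma cyclic_projective : rel_projective B X.
Proof.
have sD : {morph section : u u' / u + u'}.
  move=> u u'; rewrite /section -big_split; apply: eq_bigr => v _.
  by rewrite valueD !scalerDl.
have s0 : section 0 = 0 by apply: (addrI (section 0)); rewrite -sD !addr0.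
have sK k u : section (k%:A *: u) = k%:A *: section u.
  rewrite /section scaler_sumr; apply: eq_bigr => v _.
  by rewrite value_scalar scalarM.
have se w u : section (e w *: u) = e w *: section u.
  rewrite /section scaler_sumr; apply: eq_bigr => v _.
  rewrite value_videm scalar_comm [e w *: _]scale_pure videm_g (inj_eq (@label_inj n)) eq_sym.
  by case: eqP => _; rewrite ?pure0l ?scaler0 ?scale0r.
have sf i u : section (f i *: u) = f i *: section u.
  rewrite /column_idem !scaler_suml (big_morph section sD s0).
  by apply: eq_bigr => v _.
have sa u : section (a *: u) = a *: section u.
  pose F (x : arrow Q) := if T (label (tgt x)) then
    (value u (label (src x)))%:A *: pure B (g (tgt x)) omega else 0.
  transitivity (\sum_x F x).
    rewrite (partition_big (@tgt _ Q) predT) //; apply: eq_bigr => v _.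
    case: (boolP (T (label v))) => Tv; last first.
      rewrite value_out // scale0r scale0r big1 // => x /eqP xv.
      by rewrite /F xv (negPf Tv).
    rewrite value_scale // pcoef_vertex_total mul0r add0r.
    rewrite !scaler_suml; apply: eq_bigr => x /eqP xv.
    by rewrite pcoef_arrow_total mul1r /F xv Tv.
  rewrite (partition_big (@src _ Q) predT) // /section [RHS]scaler_sumr; apply: eq_bigr => v _.
  rewrite scalar_comm [a *: _]scale_pure.
  case: (boolP (T (label v))) => Tv; last first.
    rewrite value_out // !scale0r big1 // => x /eqP xv.
    by rewrite /F xv value_out // !scale0r; case: ifP.
  rewrite total_g // [RHS]scaler_sumr [RHS]big_mkcondr; apply: eq_bigr => x /eqP xv.
  by rewrite /F xv.
have sB := gens_sub_linear sD sK sf sa.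
pose l := GRing.isLinear.Build _ _ _ _ _ (vertex_linear sB se).
exists (HB.pack section l : {linear X -> tensor B X}) => u /=.
rewrite [RHS]basis_sum (big_morph _ (@mult_mapD K A B X) (id1 := 0)) ?linear0 //.
apply: eq_bigr => v _; rewrite mult_mapZ mult_map_pure.
case: (boolP (T (label v))) => Tv; first by rewrite g_omega.
by rewrite value_out // !scale0r.
Qed.

End Cyclic.

End ThinModule.

(** * Truncation maps between thin modules *)

Section Restriction.

Variables (K : fieldType) (n : nat) (T T' : pred nat).
Variables (T_free : path_free n T) (T'_free : path_free n T') (D : pred nat).
Hypothesis DT : forall l, D l -> T l.
Hypothesis DT' : forall l, D l -> T' l.
Hypothesis D_arrow : forall x : arrow (zigzag n),
  T (label (src x)) -> T' (label (tgt x)) -> D (label (src x)) = D (label (tgt x)).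

Local Notation X := (@thin K n T T_free).
Local Notation Y := (@thin K n T' T'_free).

Definition restrict (u : X) : Y :=
  thin_of _ (fun v => if D (label v) then value u (label v) else 0).

Lemma value_restrict u l : value (restrict u) l = if D l then value u l else 0.
Proof.
move: l; apply: value_ext => [v Tv|l Tl]; first by rewrite value_of.
case: ifP => // Dl; rewrite value_junk //; move: Tl; rewrite DT' // DT //.
Qed.

Fact restrict_linear : linear restrict.
Proof.
move=> g u u'; apply: value_inj => v Tv.
rewrite valueD !value_restrict valueD [in RHS]value_scale // value_restrict.
case: (boolP (D (label v))) => Dv.
  rewrite value_scale ?DT //; congr (_ + _ + _); apply: eq_bigr => x /eqP xv.
  rewrite value_restrict; case: (boolP (T (label (src x)))) => Tx.
    by rewrite (D_arrow Tx) ?xv ?Dv // DT'.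
  by rewrite value_out ?if_same.
rewrite mulr0 add0r big1 ?addr0 // => x /eqP xv; rewrite value_restrict.
case: (boolP (T (label (src x)))) => Tx; last by rewrite value_out ?if_same ?mulr0.
by rewrite (D_arrow Tx) ?xv // (negPf Dv) mulr0.
Qed.

End Restriction.

(** * The lower bound *)

(** The least label of the i-th support. For i = 0 it is 0, which names no vertex, and only the
    vertices 1 and 2 remain. *)
Definition bottom (i : nat) : nat :=
  if odd i then (if i == 1 then 1 else i - 1)%N else i.

Definition witness_support (i : nat) : pred nat :=
  fun l => [|| l == bottom i, l == i.+1 | l == i.+2].

(** The support of a syzygy: the simple module at i + 2 for odd i, and the uniserial module with top
    [bottom i.+1] and socle i + 2 for even i. *)
Definition boundary_support (i : nat) : pred nat :=
  fun l => (l == i.+2) || ~~ odd i && (l == bottom i.+1).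

Lemma inflow_even (K : fieldType) (G : nat -> K) m : ~~ odd m ->
  inflow G m.+2 = G m + G m.+1.
Proof. by move=> m_even; rewrite /inflow /= negbK (negPf m_even) !subSS !subn0. Qed.

Lemma inflow_odd (K : fieldType) (G : nat -> K) m : ~~ odd m ->
  inflow G m.+3 = G (bottom m.+1).
Proof.
by move=> m_even; rewrite /inflow /bottom /= negbK m_even !subSS !subn0 !eqSS.
Qed.

Lemma inflow0 (K : fieldType) (G : nat -> K) l :
  (forall l', (l'./2).+1 = l./2 -> G l' = 0) -> inflow G l = 0.
Proof.
rewrite /inflow => G0; case: ifP => // l1; case: ifP => l_odd.
  by apply: G0; case: (l =P 3%N) => l3; lia.
by rewrite !G0 ?addr0 //; lia.
Qed.

(** Both vertices receive only from [bottom i] within the support. This makes the differences in the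
    odd case of [contraction_form] vanish on the image of a. *)
Lemma inflow_top (K : fieldType) (G : nat -> K) i : odd i -> G 0%N = 0 ->
    (forall l, ~~ witness_support i l -> G l = 0) ->
  inflow G i.+1 = inflow G i.+2.
Proof.
case: i => // m /= m_even G0 Gout; rewrite inflow_even // inflow_odd //.
rewrite /bottom /= m_even; case: (m.+1 =P 1%N) => m1.
  by rewrite (_ : m = 0%N) ?G0 ?add0r //; lia.
rewrite subn1 /= [X in _ + X]Gout ?addr0 // /witness_support /bottom /= m_even.
by case: (m.+1 =P 1%N) => //; lia.
Qed.

(* valid in degrees at most n: otherwise the vertex i.+2 may be missing *)
Definition contraction_form (K : fieldType) (i : nat) (G : nat -> K) (l : nat) : K :=
  if odd i then
    if l == i.+1 then G i.+1 - G i.+2 else if l == i.+2 then G i.+2 - G i.+1 else 0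
  else if l == bottom i.+1 then G i + G i.+1 else G i.+2.

(** * The contracting homotopy in coordinates *)

Section Contraction.

Variables (K : fieldType) (N i : nat) (G : nat -> K).
Hypothesis le_iN : (i.+2 <= N)%N.
Hypothesis G0 : G 0%N = 0.
Hypothesis Gout : forall l, ~~ witness_support i l -> G l = 0.

Let total l := if (0 < l <= N)%N && witness_support i l then inflow G l else 0.
Let contr l :=
  if (0 < l <= N)%N && witness_support i.+1 l then contraction_form i G l else 0.

Lemma bottomS_odd : odd i -> bottom i.+1 = i.+1.
Proof. by rewrite /bottom /= => ->. Qed.

Lemma bottomS_even : ~~ odd i -> bottom i.+1 = if i == 0%N then 1%N else i.
Proof. by rewrite /bottom /= subn1 eqSS => ->. Qed.

Lemma witness_column l : witness_support i l -> i./2 = l./2 \/ (i./2).+1 = l./2.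
Proof.
rewrite /witness_support /bottom.
by case: (boolP (odd i)) => i_odd; case: (i =P 1%N) => i1; lia.
Qed.

(** For odd i the two opposite values cancel at their common target i + 3, and both vanish on the
    image of a. For even i the new bottom vertex carries G(i) + G(i+1) and sends it to both i + 2
    and i + 3, in agreement with the duplicated G(i+2). *)
Lemma contraction_form_total l : (0 < l <= N)%N -> witness_support i.+1 l ->
  contraction_form i total l = inflow contr l.
Proof.
move=> rl; have total_bottom m : m./2 = i./2 -> total m = 0.
  move=> mi; rewrite /total inflow0 ?if_same // => m' m'm; apply: Gout.
  by apply/negP => /witness_column; lia.
have contr_bottom m : m./2 = i.+1./2 -> inflow contr m = 0.
  move=> mi; apply: inflow0 => m' m'm; rewrite /contr.
  case: (boolP (witness_support _ _)); last by rewrite andbF.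
  rewrite /witness_support; case: (boolP (odd i)) => i_odd.
    by rewrite bottomS_odd //; lia.
  by rewrite bottomS_even //; case: (i =P 0%N) => i0; lia.
rewrite /witness_support /contraction_form; case: (boolP (odd i)) => i_odd.
  have E : total i.+1 = total i.+2.
    rewrite /total /witness_support !eqxx !orbT /= ltnW //= le_iN.
    exact: inflow_top.
  rewrite bottomS_odd //; case/or3P=> /eqP ->.
  - by rewrite eqxx E subrr contr_bottom.
  - by rewrite eqxx E subrr if_same contr_bottom //; lia.
  - have -> : (i.+3 == i.+1) = false by lia.
    have -> : (i.+3 == i.+2) = false by lia.
    rewrite inflow_even; last by rewrite /= negbK.
    rewrite /contr /witness_support /contraction_form i_odd.
    rewrite bottomS_odd // !eqxx !orbT /= ltnW //= le_iN.
    have -> : (i.+2 == i.+1) = false by lia.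
    by rewrite addrC subrKA subrr.
rewrite bottomS_even //; case: (l =P _) => [lE _|lne].
  have lE2 : l./2 = i./2 by rewrite lE; case: (i =P 0%N); lia.
  rewrite !total_bottom //; last by lia.
  by rewrite addr0 contr_bottom //; lia.
have total2 : total i.+2 = G i + G i.+1.
  by rewrite /total /witness_support eqxx !orbT le_iN inflow_even.
have contr2 : contr i + contr i.+1 = G i + G i.+1.
  rewrite /contr /witness_support bottomS_even // /contraction_form (negPf i_odd) bottomS_even //.
  case: (i =P 0%N) => [->|i0].
    by rewrite /= add0r; case: (N) le_iN.
  rewrite (_ : (0 < i <= N)%N = true) ?eqxx /=; last by lia.
  by rewrite [in X in _ + X](_ : [|| _, _ | _] = false) ?andbF ?addr0 //; lia.
case/or3P=> /eqP // ->; first by rewrite total2 inflow_even // contr2.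
rewrite total2 inflow_odd // bottomS_even // -contr2.
case: (i =P 0%N) => [i0|i0].
  rewrite [contr i](_ : _ = 0) ?add0r ?i0 // /contr i0 //.
have Ti : witness_support i.+1 i.+1 = false.
  by rewrite /witness_support bottomS_even //; case: (i =P 0%N) => //; lia.
by rewrite [contr i.+1]/contr Ti andbF addr0.
Qed.

End Contraction.

(** For even i the duplicate of G(i+2) at i + 3 is corrected by the difference G(i+3) - G(i+2) from
    the next degree. For odd i the value -G(i+2) at i + 1 cancels against G(i+1) + G(i+2). *)
Lemma contraction_form_homotopy (K : fieldType) N i (G : nat -> K) l :
    (i.+3 <= N)%N -> G 0%N = 0 -> (0 < l <= N)%N -> witness_support i.+1 l ->
  (if boundary_support i.+1 l then
     if (0 < l <= N)%N && witness_support i.+2 l then contraction_form i.+1 G l else 0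
   else 0) +
  contraction_form i (fun m => if boundary_support i m then G m else 0) l = G l.
Proof.
move=> le_iN G0 rl; rewrite rl andTb.
rewrite /witness_support /boundary_support /contraction_form oddS.
case: (boolP (odd i)) => i_odd /=.
  rewrite !orbF bottomS_odd // (@bottomS_even i.+1) /= ?negbK // => /or3P[]/eqP->.
  - rewrite !eqxx !orbT /=.
    have -> : (i.+1 == i.+2) = false by lia.
    by rewrite sub0r addrK.
  - have -> : (i.+2 == i.+1) = false by lia.
    have -> : (i.+2 == i.+3) = false by lia.
    have -> : (i.+1 == i.+2) = false by lia.
    by rewrite eqxx subr0 add0r.
  - have -> : (i.+3 == i.+1) = false by lia.
    have -> : (i.+3 == i.+2) = false by lia.
    by rewrite !eqxx orbT addr0.
rewrite (@bottomS_odd i.+1) // bottomS_even // !eqxx /= orbF.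
case: (l =P _) => [-> _|lne].
  case: (i =P 0%N) => [->|i0] /=; first by rewrite !add0r.
  rewrite eqxx !orbT.
  have -> : (i == i.+3) = false by lia.
  have -> : (i.+1 == i.+2) = false by lia.
  have -> : (i.+1 == i) = false by lia.
  by rewrite addr0 add0r.
rewrite orFb => /orP[]/eqP->.
  have -> : (i.+2 == i.+3) = false by lia.
  by rewrite add0r.
have -> : (i.+3 == i.+2) = false by lia.
by rewrite eqxx orbT subrK.
Qed.

Section LowerBound.

Variables (K : fieldType) (n : nat).

Local Notation A := (zigzag_alg K n).
Local Notation B := (zigzag_subalg K n).
Local Notation Q := (zigzag n).
Local Notation V := 'I_n.+2.
Local Notation e := (@videm K n.+1 Q).
Local Notation f := (column_idem K n).
Local Notation a := (total_arrow K n).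

Lemma witness_path_free i : path_free n (witness_support i).
Proof.
move=> x y xy; have := arrow_edge x; have := arrow_edge y; rewrite -xy.
rewrite /zigzag_edge /witness_support /bottom.
by case: (boolP (odd i)) => i_odd; case: (i =P 1%N) => i1; lia.
Qed.

(** In degree n + 1 the vertex n + 3 is missing. That term is used only as the source of the n-th
    boundary and the target of the n-th contraction, never as a projective. *)
Definition witness (i : nat) : lmodType A := @thin K n _ (@witness_path_free i).

Lemma boundary_source i l : boundary_support i l -> witness_support i.+1 l.
Proof.
rewrite /boundary_support /witness_support /=.
by case/orP=> [|/andP[_]] ->; rewrite ?orbT.
Qed.

Lemma boundary_target i l : boundary_support i l -> witness_support i l.
Proof.
rewrite /boundary_support /witness_support /bottom /=.
by case: (boolP (odd i)) => i_odd /=; case: (i.+1 =P 1%N) => i1; case: (i =P 1%N) => i2; lia.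
Qed.

Lemma boundary_arrow i (x : arrow Q) : witness_support i.+1 (label (src x)) ->
  witness_support i (label (tgt x)) ->
  boundary_support i (label (src x)) = boundary_support i (label (tgt x)).
Proof.
have := arrow_edge x; move: (label (src x)) (label (tgt x)) => p q.
rewrite /zigzag_edge /boundary_support /witness_support /bottom /=.
case: (boolP (odd i)) => i_odd /=; case: (i.+1 =P 1%N) => i1; case: (i =P 1%N) => i2; lia.
Qed.

Definition boundary_map i : witness i.+1 -> witness i :=
  restrict (@witness_path_free i) (boundary_support i).

Fact boundary_linear i : linear (@boundary_map i).
Proof.
exact: (restrict_linear _ (@boundary_source i) (@boundary_target i) (@boundary_arrow i)).
Qed.

Definition boundary i : {linear witness i.+1 -> witness i} :=
  HB.pack (@boundary_map i) (GRing.isLinear.Build _ _ _ _ _ (@boundary_linear i)).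

Lemma value_boundary i (u : witness i.+1) l :
  value (boundary i u) l = if boundary_support i l then value u l else 0.
Proof. exact: (value_restrict _ (@boundary_source i) (@boundary_target i)). Qed.

Lemma boundary_boundary i (u : witness i.+2) : boundary i (boundary i.+1 u) = 0.
Proof.
apply: value_inj => v Tv; rewrite !value_boundary value_zero.
case: ifP => // D1; case: ifP => // D2; exfalso; move: D1 D2.
rewrite /boundary_support /bottom /=.
by case: (boolP (odd i)) => i_odd /=; case: (i.+1 =P 1%N) => i1; lia.
Qed.

Definition contraction i (u : witness i) : witness i.+1 :=
  thin_of _ (fun v => contraction_form i (value u) (label v)).

Lemma value_contraction i (u : witness i) l : value (contraction u) l =
  if (0 < l <= n.+2)%N && witness_support i.+1 l then contraction_form i (value u) l else 0.
Proof.
move: l; apply: value_ext => [v Tv|l Tl]; last by rewrite (negPf Tl).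
have -> : (0 < label v <= n.+2)%N by rewrite /label /=; have := ltn_ord v.
by rewrite value_of // Tv.
Qed.

Lemma contractionD i : {morph @contraction i : u u' / u + u'}.
Proof.
move=> u u'; apply: value_inj => v Tv; rewrite valueD !value_contraction.
case: ifP => _; last by rewrite addr0.
rewrite /contraction_form !valueD; do ![case: ifP => _]; by [rewrite ?addr0 // | ring].
Qed.

Lemma contraction_scalar i k (u : witness i) : contraction (k%:A *: u) = k%:A *: contraction u.
Proof.
apply: value_inj => v Tv; rewrite value_scalar !value_contraction.
case: ifP => _; last by rewrite mulr0.
rewrite /contraction_form !value_scalar; do ![case: ifP => _]; by [rewrite ?mulr0 // | ring].
Qed.

Lemma contraction_column i j (u : witness i) : contraction (f j *: u) = f j *: contraction u.
Proof.
apply: value_inj => v Tv; rewrite value_column !value_contraction Tv.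
case: (0 < _ <= _)%N; last by rewrite if_same.
rewrite andTb.
rewrite /contraction_form !value_column.
move: (label v) Tv; rewrite /witness_support => l.
case: (boolP (odd i)) => i_odd Tl.
  case: (l =P i.+1) => [->|l1]; last case: (l =P i.+2) => [->|l2]; last by rewrite if_same.
    have -> : i.+2./2 = i.+1./2 by lia.
    by case: eqP; rewrite ?subr0.
  have -> : i.+1./2 = i.+2./2 by lia.
  by case: eqP; rewrite ?subr0.
case: (l =P bottom i.+1) => [->|l1].
  have -> : i.+1./2 = i./2 by lia.
  have -> : (bottom i.+1)./2 = i./2 by rewrite /bottom /= i_odd; case: eqP; lia.
  by case: eqP; rewrite ?addr0.
by have -> : l./2 = i.+2./2 by lia.
Qed.

Lemma contraction_total i (u : witness i) : (i <= n)%N ->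
  contraction (a *: u) = a *: contraction u.
Proof.
move=> le_in; apply: value_inj => v Tv.
have rv : (0 < label v <= n.+2)%N by rewrite /label /=; have := ltn_ord v.
rewrite value_contraction value_total rv Tv !andTb.
rewrite (funext (value_total u)) (funext (value_contraction u)).
by apply: contraction_form_total => //; [exact: value0 | exact: value_out].
Qed.

Lemma contraction_sub_linear i : (i <= n)%N -> sub_linear B (@contraction i).
Proof.
move=> le_in; apply: gens_sub_linear.
- exact: contractionD.
- exact: contraction_scalar.
- exact: contraction_column.
- by move=> u; apply: contraction_total.
Qed.

Lemma boundary_contraction0 (u : witness 0) : boundary 0 (contraction u) = u.
Proof.
apply: value_inj => v Tv; rewrite value_boundary value_contraction.
have rv : (0 < label v <= n.+2)%N by rewrite /label /=; have := ltn_ord v.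
rewrite rv; move: (label v) rv Tv => l rl.
have v0 := value0 u.
by case: l rl => [|[|[|l]]] //= _; rewrite /contraction_form /= v0 add0r.
Qed.

Lemma boundary_contraction i (u : witness i.+1) : (i.+1 <= n)%N ->
  boundary i.+1 (contraction u) + contraction (boundary i u) = u.
Proof.
move=> lt_in; apply: value_inj => v Tv; rewrite valueD value_boundary !value_contraction.
have rv : (0 < label v <= n.+2)%N by rewrite /label /=; have := ltn_ord v.
rewrite {2}rv Tv andTb (funext (value_boundary u)).
by apply: contraction_form_homotopy => //; exact: value0.
Qed.

(** * Relative projectivity of the witness modules *)

Lemma label_range (v : V) : (0 < label v <= n.+2)%N.
Proof. by rewrite /label /=; have := ltn_ord v. Qed.

(** This is the projective module A e_r, with r the bottom vertex: every arrow leaving r stays in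
    the support and nothing else happens there. *)
Lemma witness_projective_even i : (i < n)%N -> ~~ odd i ->
  rel_projective B (witness i.+1).
Proof.
move=> lt_in i_even; have bE := bottomS_even i_even.
have [r lr] : exists v : V, label v = bottom i.+1.
  by apply: vertex_of_label; rewrite bE; case: (i =P 0%N); lia.
pose omega : witness i.+1 := basis _ _ r.
have Tr : witness_support i.+1 (label r) by rewrite lr /witness_support eqxx.
have above v : witness_support i.+1 (label v) -> v != r ->
    label v = i.+2 \/ label v = i.+3.
  move=> /or3P[]/eqP lv; [|by left|by right].
  by rewrite -(inj_eq (@label_inj n)) lr lv eqxx.
have source_r (x : arrow Q) : witness_support i.+1 (label (src x)) ->
    witness_support i.+1 (label (tgt x)) -> src x = r.
  have := arrow_edge x => xe Tx Ty; apply: contrapT => /eqP nr.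
  have /above /(_ nr) := Tx; move: xe Ty; rewrite /zigzag_edge /witness_support bE.
  by case: (i =P 0%N) => i0; lia.
have target_r (x : arrow Q) : src x = r -> witness_support i.+1 (label (tgt x)).
  move=> xr; have := arrow_edge x; rewrite xr lr /zigzag_edge /witness_support bE.
  by case: (i =P 0%N) => i0; lia.
pose g (v : V) : A := if v == r then e r else e v * a * e r.
apply: (@cyclic_projective _ _ _ _ omega g) => [w v|v Tv|v Tv].
- rewrite /g; case: (v =P r) => [->|_]; first exact: videmM.
  by rewrite !mulrA videmM; case: eqP => _; rewrite ?mul0r.
- apply: value_inj => w Tw; rewrite value_basis Tw andTb.
  rewrite /g; case: (eqVneq v r) => [->|vr].
    by rewrite value_videm value_basis Tw; case: eqP.
  rewrite -!scalerA value_videm value_total label_range Tw andTb.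
  case: eqP => // lwv; rewrite lwv.
  have er : value (e r *: omega) =1 value omega.
    move=> l; rewrite value_videm value_basis; case: eqP => //= _.
    by rewrite andbF.
  have -> : inflow (value (e r *: omega)) (label v) = inflow (value omega) (label v).
    by congr inflow; apply: funext.
  have [->|->] := above v Tv vr.
    rewrite inflow_even // !value_basis lr bE /witness_support bE.
    by case: (i =P 0%N) => [->|i0]; [rewrite /= add0r | rewrite !eqxx (_ : (i.+1 == i) = false) ?andbF ?addr0 //; lia].
  by rewrite inflow_odd // value_basis -lr Tr eqxx.
- rewrite /g; case: (eqVneq v r) => [->|vr]; last first.
    rewrite !mulrA total_videm_total mul0r pure0l big_pred0 // => x.
    by apply/negP => /andP[/eqP xv Tx]; move: vr; rewrite -xv (source_r x) ?xv ?eqxx.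
  rewrite total_videmE pure_suml; apply: eq_big => [x|x /eqP xr].
    by case: (eqVneq (src x) r) => [/target_r ->|].
  rewrite ifF; last first.
    apply/negP => /eqP xr'; have := arrow_edge x.
    by rewrite xr xr' /zigzag_edge; lia.
  by rewrite (@videm_total K n r (tgt x) x).
Qed.

(** This is A (x)_B S, with S the one-dimensional B-module of the column of i + 1, spanned by omega.
    As a kills omega, the arrows i + 1 -> i + 3 and i + 2 -> i + 3 become opposite in the tensor
    product, and i + 1 -> i + 4, if present, becomes zero. *)
Lemma witness_projective_odd i : (i < n)%N -> odd i -> rel_projective B (witness i.+1).
Proof.
move=> lt_in i_odd; have bE := bottomS_odd i_odd.
have [v0 l0] : exists v : V, label v = i.+1 by apply: vertex_of_label; lia.
have [v1 l1] : exists v : V, label v = i.+2 by apply: vertex_of_label; lia.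
have [w lw] : exists v : V, label v = i.+3 by apply: vertex_of_label; lia.
have n01 : v0 != v1 by rewrite -(inj_eq (@label_inj n)) l0 l1; lia.
have n0w : w != v0 by rewrite -(inj_eq (@label_inj n)) l0 lw; lia.
have n1w : w != v1 by rewrite -(inj_eq (@label_inj n)) l1 lw; lia.
pose T := witness_support i.+1.
have T0 : T (label v0) by rewrite /T /witness_support l0 bE eqxx.
have T1 : T (label v1) by rewrite /T /witness_support l1 eqxx orbT.
have Tw : T (label w) by rewrite /T /witness_support lw eqxx !orbT.
have vertices v : T (label v) -> [\/ v = v0, v = v1 | v = w].
  case/or3P=> /eqP lv; [apply: Or31 | apply: Or32 | apply: Or33];
    by apply: label_inj; rewrite lv ?bE.
have [x0 [sx0 tx0]] : exists x : arrow Q, src x = v0 /\ tgt x = w.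
  by apply: edge_arrow; rewrite l0 lw /zigzag_edge; lia.
have [x1 [sx1 tx1]] : exists x : arrow Q, src x = v1 /\ tgt x = w.
  by apply: edge_arrow; rewrite l1 lw /zigzag_edge; lia.
have tgt_w (x : arrow Q) : T (label (src x)) -> T (label (tgt x)) -> tgt x = w.
  move: (arrow_edge x) => + Tx Ty; move: Tx Ty; rewrite /T /witness_support bE => Tx Ty xE.
  by apply: label_inj; rewrite lw; move: Tx Ty xE; rewrite /zigzag_edge; clear -i_odd; lia.
have n12 : (i.+1 == i.+2) = false by lia.
have n21 : (i.+2 == i.+1) = false by lia.
(* The sign makes the contributions of the two arrows into [w] cancel, so that a omega = 0. *)
pose omega : witness i.+1 := basis _ _ v0 - basis _ _ v1.
have omegaE l : value omega l = (l == i.+1)%:R - (l == i.+2)%:R.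
  have valueN (u : witness i.+1) : value (- u) l = - value u l.
    by apply: (addrI (value u l)); rewrite -valueD !subrr value_zero.
  have absorb v : T (label v) -> T l && (l == label v) = (l == label v).
    by move=> Tv; case: eqP => [->|_]; rewrite ?andbF ?andbT.
  by rewrite valueD valueN !value_basis !absorb // l0 l1.
have omega0 : value omega i.+1 = 1 by rewrite omegaE eqxx n12 subr0.
have omega1 : value omega i.+2 = - 1 by rewrite omegaE eqxx n21 sub0r.
have omega_out l : l./2 != i.+1./2 -> value omega l = 0.
  move=> nl; rewrite omegaE; case: (l =P i.+1) => [lE|_]; first by rewrite lE eqxx in nl.
  case: (l =P i.+2) => [lE|_]; last by rewrite subrr.
  have half2 : i.+2./2 = i.+1./2 by clear -i_odd; lia.
  by rewrite lE half2 eqxx in nl.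
pose g (v : V) : A :=
  if v == v0 then e v0 else if v == v1 then - e v1 else e v * a * e v0.
have s2 : label v0 = (i.+1)./2.*2 by rewrite l0; lia.
have s21 : label v1 = (i.+1)./2.*2.+1 by rewrite l1; lia.
have fE := column_pair K s2 s21.
have a_omega : a *: (f (i.+1)./2 *: omega) = 0.
  apply: value_inj => v Tv; rewrite value_total label_range Tv andTb value_zero.
  apply: etrans (_ : inflow (value omega) (label v) = 0).
    congr inflow; apply: funext => l; rewrite value_column.
    by case: eqP => // /eqP nl; rewrite omega_out.
  have inflow_column : (label v)./2 = i.+1./2 -> inflow (value omega) (label v) = 0.
    move=> cv; apply: inflow0 => l ll; apply: omega_out; rewrite -cv -ll.
    by rewrite eq_sym (gtn_eqF (ltnSn _)).
  case: (vertices _ Tv) => vE; rewrite vE in inflow_column *.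
  - by apply: inflow_column; rewrite s2 doubleK.
  - by apply: inflow_column; rewrite s21 /= uphalf_double.
  - by rewrite lw inflow_even ?oddS ?negbK // omega0 omega1 subrr.
have kill b : pure B (b * (a * f (i.+1)./2)) omega = 0.
  by rewrite pure_bal ?memvM ?total_in ?column_in // -scalerA a_omega pure0r.
have tail0 : pure B (a * e v0) omega = pure B (e w * a * e v0) omega.
  rewrite -[a * e v0]mul1r radsq_oneE mulr_suml pure_suml (bigD1 w) //= mulrA.
  rewrite big1 ?addr0 // => v vw; rewrite mulrA.
  (* Since i + 2 -> i + 4 is not an arrow, away from [w] one may replace e_v0 by the whole column
     idempotent, and a f then moves onto omega. *)
  have -> : e v * a * e v0 = e v * (a * f (i.+1)./2).
    rewrite fE mulrDr mulrDr !mulrA [X in _ = _ + X]videm_total0 ?addr0 // l1.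
    move: vw; rewrite -(inj_eq (@label_inj n)) lw /zigzag_edge.
    by have := label_range v; lia.
  exact: kill.
have tail1 : pure B (a * - e v1) omega = pure B (e w * a * e v0) omega.
  rewrite -tail0 mulrN pureNl; apply/eqP; rewrite eq_sym -addr_eq0 -pureDl -mulrDr -fE.
  by rewrite -[a * _]mul1r kill.
apply: (@cyclic_projective _ _ _ _ omega g) => [u v|v Tv|v Tv].
- rewrite /g; case: (v =P v0) => [->|_]; first exact: videmM.
  case: (v =P v1) => [->|_]; last by rewrite !mulrA videmM; case: eqP => _; rewrite ?mul0r.
  by rewrite mulrN videmM; case: eqP => _; rewrite ?oppr0.
- apply: value_inj => u Tu; rewrite value_basis Tu andTb.
  have valueN (y : witness i.+1) l : value (- y) l = - value y l.
    by apply: (addrI (value y l)); rewrite -valueD !subrr value_zero.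
  rewrite /g; case: (eqVneq v v0) => [->|nv0].
    by rewrite value_videm (inj_eq (@label_inj n)); case: eqP => // ->; rewrite l0 omega0.
  case: (eqVneq v v1) => [->|nv1].
    rewrite scaleNr valueN value_videm (inj_eq (@label_inj n)).
    by case: eqP => [->|_]; rewrite ?oppr0 // l1 omega1 opprK.
  have vw : v = w by case: (vertices _ Tv) => vE //; move: nv0 nv1; rewrite vE eqxx.
  rewrite vw -!scalerA value_videm value_total label_range Tu andTb (inj_eq (@label_inj n)).
  case: eqP => // ->; rewrite lw inflow_even ?oddS ?negbK // !value_videm l0 eqxx n21.
  by rewrite omega0 addr0.
- have gw : g w = e w * a * e v0 by rewrite /g (negPf n0w) (negPf n1w).
  have tails (x : arrow Q) : src x = v -> tgt x = w ->
      \sum_(y : arrow Q | (src y == v) && T (label (tgt y))) pure B (g (tgt y)) omega =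
      pure B (e w * a * e v0) omega.
    move=> xv xw; rewrite (big_pred1 x) ?xw ?gw // => y.
    apply/andP/eqP => [[/eqP yv Ty]|->]; last by rewrite xv xw eqxx Tw.
    by apply: arrow_inj; rewrite ?xv ?xw // tgt_w // yv.
  rewrite {1}/g; case: (eqVneq v v0) => [vE|nv0].
    by rewrite tail0 -(tails x0) ?vE.
  case: (eqVneq v v1) => [vE|nv1].
    by rewrite tail1 -(tails x1) ?vE.
  rewrite !mulrA total_videm_total mul0r pure0l big_pred0 // => x.
  apply/negP => /andP[/eqP xv Ty].
  have vw : v = w by case: (vertices _ Tv) => vE //; move: nv0 nv1; rewrite vE eqxx.
  have := column_tgt x; rewrite (tgt_w x) ?xv // vw => /eqP.
  by rewrite (ltn_eqF (ltnSn _)).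
Qed.

Lemma witness_resolution_long m : (0 < n)%N -> rel_resolution B (witness 0) m -> (n <= m)%N.
Proof.
move=> n_gt0 res; rewrite leqNgt; apply/negP => lt_mn.
have prW i : (i < n)%N -> rel_projective B (witness i.+1).
  move=> lt_in; case: (boolP (odd i)) => i_odd; first exact: witness_projective_odd.
  exact: witness_projective_even.
have [s sE] := short_resolution_split boundary_boundary contraction_sub_linear
  boundary_contraction0 boundary_contraction prW res lt_mn.
have [w lw] : exists v : V, label v = n.+2 by apply: vertex_of_label.
(* This vertex lies in the support of degree n, where it has an arrow to n + 2, but not in that of
   degree n + 1. So d of the basis vector at n + 2 is an arrow applied to a vector at l, which [s]
   must send to zero; d s d = d then fails there. *)
pose l := if odd n then bottom n else n.+1.
have [v lv] : exists v : V, label v = l.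
  by apply: vertex_of_label; rewrite /l /bottom; case: (odd n) => //; case: (n =P 1%N); lia.
have Tv : ~~ witness_support n.+1 (label v).
  rewrite lv /l /witness_support; case: (boolP (odd n)) => n_odd.
    by rewrite bottomS_odd // /bottom n_odd; case: (n =P 1%N); lia.
  by rewrite bottomS_even //; case: (n =P 0%N); lia.
have dw : boundary n (basis _ _ w) = (e w * a * e v) *: (basis _ _ v : witness n).
  apply: value_inj => u Tu; rewrite value_boundary value_basis -!scalerA value_videm.
  rewrite value_total label_range Tu andTb.
  case: eqP => [->|_]; last by rewrite andbF if_same.
  rewrite lw /boundary_support /witness_support !eqxx !orbT andbT /=.
  have bE : value (e v *: (basis _ _ v : witness n)) =1 value (basis _ _ v : witness n).
    by move=> k; rewrite value_videm value_basis; case: eqP => //; rewrite andbF.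
  rewrite (funext bE); case: (boolP (odd n)) => n_odd.
    have En : n.+2 = n.-1.+3 by lia.
    rewrite En inflow_odd ?value_basis; last by lia.
    by rewrite prednK // lv /l n_odd eqxx /witness_support eqxx.
  rewrite inflow_even // !value_basis lv /l (negPf n_odd) eqxx /witness_support eqxx orbT.
  by rewrite (_ : (n == n.+1) = false) ?andbF ?add0r //; lia.
have ev0 : e v *: s (basis _ _ v) = 0.
  apply: value_inj => u Tu; rewrite value_videm value_zero.
  by case: eqP => // uv; rewrite uv (negPf Tv) in Tu.
have /(congr1 (fun y => value y n.+2)) := sE (basis _ _ w).
rewrite dw linearZZ -[in LHS]scalerA ev0 scaler0 linear0 value_zero -dw.
rewrite value_boundary value_basis lw /boundary_support /witness_support !eqxx /= orbT.
by move/eqP; rewrite eq_sym oner_eq0.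
Qed.

End LowerBound.

Theorem proposition5p5 (K : fieldType) (K_perfect : perfect_field K)
    (n : nat) (n_ge1 : (1 <= n)%N) :
  rel_gldim (zigzag_subalg K n) = Some n.
Proof.
apply: inf_natE => [M fgM|m le_pd].
  by apply/le_infP; exists n => //; apply/rel_dim_resolution/zigzag_rel_dim.
have /le_infP[i le_im res] := le_pd (witness K n 0) (thin_fin_gen _ _).
by apply: leq_trans le_im; apply: witness_resolution_long res.
Qed.
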